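(* Let $f$ be a real-valued Z-additive function. Then $f$ has a distribution function $F$, i.e. the limit $F(y)=\lim_{N\to\infty}\frac1N\#\{n<N: f(n)\leqslant y\}$ exists for every continuity point $y$ and defines a distribution function, if and only if the two series \[ \sum_{j\geqslant2}f(F_j)\quad\text{and}\quad\sum_{j\geqslant2}f(F_j)^2 \] converge. In this case the characteristic function $\varphi(t)=\int e^{ity}\,dF(y)$ of the limiting distribution is given by \[ \varphi(t)=\frac{\sqrt5}{\gamma}\prod_{j\geqslant2}\frac{r_j(t)}{\gamma}, \] where $r_2(t)=1$ and $r_{j+1}(t)=1+\dfrac{e^{itf(F_j)}}{r_j(t)}$ for $j\geqslant2$, provided that $r_j(t)\neq0$ for all $j\geqslant2$.
   Context: $F_0=0$, $F_1=1$, $F_k=F_{k-1}+F_{k-2}$ are the Fibonacci numbers and $\gamma=(1+\sqrt5)/2$. Every positive integer $n$ has a unique Zeckendorf representation $n=\sum_{i\geqslant2}\delta_i(n)F_i$ with $\delta_i(n)\in\{0,1\}$ and $\delta_i(n)=1\Rightarrow\delta_{i+1}(n)=0$. A function $f$ on the nonnegative integers is Z-additive if $f(0)=0$ and $f(n)=\sum_{i\geqslant2}f(\delta_i(n)F_i)$; it is determined by the values $f(F_i)$, $i\geqslant 2$. *)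

(* Defs.v *)
From HB Require Import structures.
From mathcomp Require Import all_boot all_order all_algebra.
From mathcomp Require Import all_classical all_reals all_analysis.
From mathcomp Require Import complex zify.

Set Implicit Arguments.
Unset Strict Implicit.
Unset Printing Implicit Defensive.

Import Order.TTheory GRing.Theory Num.Theory.
Import numFieldNormedType.Exports.

Local Open Scope classical_set_scope.
Local Open Scope ring_scope.

Fixpoint fib (k : nat) : nat :=
  match k with
  | 0 => 0
  | k'.+1 => match k' with 0 => 1 | k''.+1 => fib k' + fib k'' end
  end%N.

(* The bound i < n.+2 only makes the sum finite: fib i > n as soon as
   i >= n.+2, so such a digit cannot occur (see [leq_fibS]). *)
Definition zeckendorf (n : nat) (delta : nat -> bool) : Prop :=
  [/\ forall i, delta i -> (2 <= i < n.+2)%N,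
      forall i, delta i -> delta i.+1 = false
    & n = (\sum_(2 <= i < n.+2) delta i * fib i)%N].

Lemma fibSS k : fib k.+2 = (fib k.+1 + fib k)%N.
Proof. by []. Qed.

Arguments fib : simpl never.

Lemma leq_fibS i : (i <= (fib i).+1)%N.
Proof.
suff: (i <= (fib i).+1)%N && (i.+1 <= (fib i.+1).+1)%N by case/andP.
elim: i => // i /andP[IH1 IH2]; rewrite IH2 andTb.
case: i IH1 IH2 => [|[|i]] // IH1 IH2; rewrite fibSS; lia.
Qed.

Lemma zeckendorf_lt (d : nat -> bool) k :
  (forall i, d i -> d i.+1 = false) ->
  (\sum_(2 <= i < k.+2) d i * fib i < fib k.+2)%N.
Proof.
move=> dN; suff: (\sum_(2 <= i < k.+2) d i * fib i < fib k.+2)%N &&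
  (\sum_(2 <= i < k.+3) d i * fib i < fib k.+3)%N by case/andP.
elim: k => [|k /andP[IH1 IH2]].
  by rewrite big_geq// big_nat1; case: (d 2).
rewrite IH2 /= big_nat_recr//= fibSS.
have [dk|_] := boolP (d k.+3); last by rewrite mul0n addn0 ltn_addr.
have dk2 : d k.+2 = false.
  by apply: contraTF dk => /dN ->.
by rewrite mul1n big_nat_recr//= dk2 mul0n addn0 addnC ltn_add2l.
Qed.

Lemma zeckendorf_ex k n : (n < fib k.+2)%N -> exists d : nat -> bool,
  [/\ forall i, d i -> (2 <= i < k.+2)%N,
      forall i, d i -> d i.+1 = false
    & n = (\sum_(2 <= i < k.+2) d i * fib i)%N].
Proof.
elim/ltn_ind: k n => k IH n nk.
case: k IH nk => [|k] IH nk.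
  exists (fun=> false); split => //; rewrite big_geq//.
  by move: nk; case: n.
have [nk2|nk2] := ltnP n (fib k.+2).
  have [d [d1 d2 d3]] := IH k (ltnSn k) n nk2.
  exists d; split => // [i /d1/andP[-> /ltnW]//|].
  rewrite big_nat_recr//= -d3; case: (boolP (d k.+2)) => [/d1|_].
    by rewrite ltnn andbF.
  by rewrite addn0.
case: k IH nk nk2 => [|k] IH nk nk2.
  exists (pred1 2); split => [i /eqP->//|i /eqP->//|].
  rewrite big_nat1 /=; move: nk nk2 => /=.
  by case: n => [|[|]].
have nk3 : (n - fib k.+3 < fib k.+2)%N by rewrite ltn_subLR// -fibSS.
have [d [d1 d2 d3]] := IH k (leqnSn _) _ nk3.
exists (fun i => d i || (i == k.+3)); split.
- by move=> i /orP[/d1|/eqP ->]; lia.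
- move=> i; rewrite eqSS => /orP[di|/eqP ->].
    by rewrite d2//=; have := d1 _ di; lia.
  by apply/negbTE/negP => /orP[/d1|]; lia.
- rewrite big_nat_recr//= eqxx orbT mul1n big_nat_recr//=.
  rewrite (ltn_eqF (ltnSn _)) orbF.
  have -> : d k.+2 = false by apply/negbTE/negP => /d1; rewrite ltnn andbF.
  rewrite mul0n addn0 -[LHS](subnK nk2) d3; congr addn.
  rewrite !big_nat; apply: eq_bigr => i /andP[_ ik].
  by rewrite (ltn_eqF (ltn_trans ik (ltnSn _))) orbF.
Qed.

Lemma zeckendorf_inj (d e : nat -> bool) k :
  (forall i, d i -> d i.+1 = false) -> (forall i, e i -> e i.+1 = false) ->
  (\sum_(2 <= i < k) d i * fib i = \sum_(2 <= i < k) e i * fib i)%N ->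
  forall i, (2 <= i < k)%N -> d i = e i.
Proof.
move=> dN eN; elim: k => [_ i /andP[]//|k IH].
have [k2|k2] := ltnP k 2.
  by move=> _ i /andP[i2]; rewrite ltnS => /(leq_trans i2); rewrite leqNgt k2.
rewrite !big_nat_recr//=.
have lt (g : nat -> bool) : (forall i, g i -> g i.+1 = false) ->
    (\sum_(2 <= i < k) g i * fib i < fib k)%N.
  by case: k k2 {IH} => [|[|k]]// _; exact: zeckendorf_lt.
have [ltd lte] := (lt _ dN, lt _ eN).
move=> E; have dek : d k = e k.
  move: E; case: (d k); case: (e k) => //; rewrite mul1n mul0n addn0 => E.
    by move: lte; rewrite -E ltnNge leq_addl.
  by move: ltd; rewrite E ltnNge leq_addl.
move: E; rewrite dek => /addIn/IH{}IH i /andP[i2].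
by rewrite ltnS leq_eqVlt => /orP[/eqP->//|ik]; apply: IH; rewrite i2.
Qed.

Lemma zeckendorf_exists_unique (n : nat) :
  exists! delta : nat -> bool, zeckendorf n delta.
Proof.
have nf : (n < fib n.+2)%N by have := leq_fibS n.+2; rewrite !ltnS.
have [d [d1 d2 d3]] := zeckendorf_ex nf.
exists d; split => // e [e1 e2 e3]; apply/funext => i.
have [i2|i2] := boolP (2 <= i < n.+2)%N.
  by apply: (zeckendorf_inj d2 e2 _ i2); rewrite -d3 -e3.
by rewrite (contraNF (d1 i) i2) (contraNF (e1 i) i2).
Qed.

Definition Z_additive (R : realType) (f : nat -> R) : Prop :=
  f 0%N = 0 /\
  forall (n : nat) (delta : nat -> bool), zeckendorf n delta ->
    f n = \sum_(2 <= i < n.+2) f (delta i * fib i)%N.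

(* An element of [cumulativeBounded 0 1] is a nondecreasing right-continuous
   function with limits 0 at -oo and 1 at +oo. *)
Definition has_distribution_function (R : realType) (f : nat -> R)
    (F : cumulativeBounded (0 : R) (1 : R)) : Prop :=
  forall y : R, {for y, continuous F} ->
    #|[pred n : 'I_N | f n <= y]|%:R / N%:R @[N --> \oo] --> F y.

Definition expi (R : realType) (x : R) : R[i] := (cos x +i* sin x)%C.

(* \int e^{ity} dF(y), integrated componentwise against the
   Lebesgue-Stieltjes measure of F. *)
Definition characteristic_function (R : realType)
    (F : cumulativeBounded (0 : R) (1 : R)) (t : R) : R[i] :=
  ((\int[lebesgue_stieltjes_measure F]_y cos (t * y))
   +i* (\int[lebesgue_stieltjes_measure F]_y sin (t * y)))%C.

Definition golden (R : realType) : R := (1 + Num.sqrt 5) / 2.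

(* zratio f t j is r_j(t): r_2 = 1 and r_{j+1} = 1 + e^{itf(F_j)} / r_j for
   j >= 2; the values at j = 0, 1 are never used. *)
Fixpoint zratio (R : realType) (f : nat -> R) (t : R) (j : nat) : R[i] :=
  match j with
  | 0 => 1
  | k.+1 => if (k < 2)%N then 1
            else 1 + expi (t * f (fib k)) / zratio f t k
  end.

(* Main.v *)
(* [0, F_{k+2}) is the disjoint union of [0, F_{k+1}) and F_{k+1} + [0, F_k), and
   f (F_{k+1} + m) = a_{k+1} + f m on the second part, where a_j = f (F_j).
   Hence the averages over n < F_k of f, f^2 and e^{itf} obey two-term
   recursions whose weights converge geometrically.

   If both series converge, the recursions bound the variance by the sum of the
   a_j^2 and the mean by the partial sums of the a_j, so f is close in L^2, on
   every [0, N), to a function of finitely many low digits; the level sets of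
   such a function have natural densities, and the empirical distribution
   functions of f are almost Cauchy.

   Conversely, the recursion for the averages phi_k of e^{itf} shows that the
   sum of |e^{ita_{k+1}} - 1|^2 |phi_k|^2 is finite. Tightness bounds the a_j and
   yields one small t > 0 with |phi_k| >= 1/2 for all large k, hence the sum of
   the a_j^2 is finite. Second moments are then bounded, so the means converge
   by the Helly-Bray theorem applied to truncations, and so does the sum of the
   a_j.

   Finally r_2 ... r_k is the sum of e^{itf(n)} over n < F_k, so Helly-Bray for
   cos and sin together with Binet's formula gives the product formula. *)

From HB Require Import structures.
Require Import Defs.
From mathcomp Require Import all_boot all_order all_algebra.
From mathcomp Require Import all_classical all_reals all_analysis.
From mathcomp Require Import measurable_realfun complex zify ring lra.

Set Implicit Arguments.
Unset Strict Implicit.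
Unset Printing Implicit Defensive.

Import Order.TTheory GRing.Theory Num.Theory.
Import numFieldNormedType.Exports.

Local Open Scope classical_set_scope.
Local Open Scope ring_scope.

(** * Fibonacci numbers, the golden ratio and the limiting weights *)

Section Fibonacci.
Context {R : realType}.
Implicit Types (k n : nat).

Local Notation gam := (golden R).
Local Notation psi := (golden R)^-1.

Lemma golden_gt1 : 1 < gam.
Proof.
have s : 1 < Num.sqrt (5 : R) by rewrite -[ltLHS]sqrtr1 ltr_sqrt; lra.
rewrite /golden; lra.
Qed.

Lemma golden_neq0 : gam != 0.
Proof. by rewrite gt_eqF// (lt_trans _ golden_gt1). Qed.

Lemma golden_sqr : gam ^+ 2 = gam + 1.
Proof.
have s : Num.sqrt (5 : R) ^+ 2 = 5 by rewrite sqr_sqrtr; lra.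
rewrite /golden expr_div_n sqrrD s; lra.
Qed.

Lemma goldenV : psi = gam - 1.
Proof.
apply: (mulfI golden_neq0); rewrite divff ?golden_neq0// mulrBr -expr2.
by rewrite golden_sqr; ring.
Qed.

Lemma goldenV_gt0 : 0 < psi.
Proof. by rewrite goldenV subr_gt0 golden_gt1. Qed.

Lemma goldenV_lt1 : psi < 1.
Proof. by rewrite invf_lt1 ?golden_gt1// (lt_trans _ golden_gt1). Qed.

Lemma goldenV_sqr : psi ^+ 2 = 1 - psi.
Proof. by rewrite goldenV sqrrB golden_sqr; ring. Qed.

Lemma fib_gt0 k : (0 < k)%N -> (0 < fib k)%N.
Proof.
elim/ltn_ind: k => -[|[|k]]// IH _.
by rewrite fibSS addn_gt0 IH.
Qed.

Lemma fib_neq0 k : (fib k.+1)%:R != 0 :> R.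
Proof. by rewrite pnatr_eq0 -lt0n fib_gt0. Qed.

Lemma leq_fib k n : (k <= n)%N -> (fib k <= fib n)%N.
Proof.
elim: n => [|n IH]; first by rewrite leqn0 => /eqP ->.
rewrite leq_eqVlt => /predU1P[->//|]; rewrite ltnS => /IH /leq_trans; apply.
by case: n {IH} => // n; rewrite fibSS leq_addr.
Qed.

(** The combination cancels the growing solution gam^k of the Fibonacci recurrence; what is left is
    a power of the conjugate root -psi of x^2 = x + 1. *)
Lemma fib_golden k : (fib k.+1)%:R - gam * (fib k)%:R = (- psi) ^+ k.
Proof.
elim: k => [|k IH]; first by rewrite mulr0 subr0 expr0.
rewrite exprS -IH goldenV fibSS natrD mulrBr.
have -> : - (gam - 1) * (gam * (fib k)%:R) =
  (gam - gam ^+ 2) * (fib k)%:R by ring.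
by rewrite golden_sqr; ring.
Qed.

(* The ratio of the weights of the two parts [0, F_{k+1}) and
   F_{k+1} + [0, F_k) of [0, F_{k+2}) tends geometrically to its limit. *)
Definition fib_weight k : R := (fib k)%:R / (fib k.+2)%:R.

Lemma fib_weight0 : fib_weight 0 = 0.
Proof. by rewrite /fib_weight mul0r. Qed.

Lemma fib_weight_ge0 k : 0 <= fib_weight k.
Proof. by rewrite divr_ge0. Qed.

Lemma fib_weight_le k : fib_weight k <= 1 / 2.
Proof.
rewrite /fib_weight ler_pdivrMr ?ltr0n ?fib_gt0//.
have : (2 * fib k <= fib k.+2)%N.
  by rewrite fibSS mul2n -addnn leq_add2r leq_fib.
rewrite -(ler_nat R) natrM; lra.
Qed.

Lemma fib_weight_ge k : (0 < k)%N -> 1 / 3 <= fib_weight k.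
Proof.
move=> k0; rewrite /fib_weight ler_pdivlMr ?ltr0n ?fib_gt0//.
have : (fib k.+2 <= 3 * fib k)%N.
  case: k k0 => // k _; rewrite !fibSS.
  have := @leq_fib k k.+1 (leqnSn _); lia.
rewrite -(ler_nat R) natrM; lra.
Qed.

Lemma fib_weight_cvg k : `|fib_weight k - psi ^+ 2| <= psi ^+ k.
Proof.
have -> : fib_weight k - psi ^+ 2 = - psi ^+ 2 * (- psi) ^+ k / (fib k.+2)%:R.
  rewrite /fib_weight; apply: (mulIf (fib_neq0 k.+1)).
  rewrite mulrBl !divfK ?fib_neq0// -fib_golden fibSS natrD goldenV.
  have := golden_sqr; move: (gam) => g gg.
  (* This is psi^2 gam^2 = 1, since psi = g - 1 and g^2 = 1 + g. *)
  have E : (g - 1) ^+ 2 * (1 + g) = 1.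
    rewrite (_ : _ * _ = (g ^+ 2 - 1) * (g - 1)); last by ring.
    by rewrite gg addrK mulrBr -expr2 gg; ring.
  apply/eqP; rewrite -subr_eq0; apply/eqP.
  transitivity ((fib k)%:R * (1 - (g - 1) ^+ 2 * (1 + g))); first by ring.
  by rewrite E subrr mulr0.
have p0 n : 0 <= psi ^+ n :> R by rewrite exprn_ge0// ltW// goldenV_gt0.
rewrite !normrM normrN normfV normr_nat !normrX normrN gtr0_norm ?goldenV_gt0//.
rewrite -mulrA mulrCA ler_piMr// mulr_ile1//.
  by rewrite exprn_ile1 ?(ltW goldenV_gt0) ?(ltW goldenV_lt1).
by rewrite invf_le1 ?ltr0n ?fib_gt0// ler1n fib_gt0.
Qed.

(** The full geometric series is 1 / (1 - psi) = 1 / psi^2 = gam^2. *)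
Lemma sum_goldenV m n : \sum_(m <= k < n) psi ^+ k <= gam ^+ 2.
Proof.
have pos k : 0 <= psi ^+ k by rewrite exprn_ge0// ltW// goldenV_gt0.
apply: (@le_trans _ _ (\sum_(0 <= k < n) psi ^+ k)).
  have [mn|nm] := leqP m n; last by rewrite big_geq ?sumr_ge0// ltnW.
  by rewrite [leRHS](@big_cat_nat _ _ _ m)//= lerDr sumr_ge0.
suff : psi ^+ 2 * (\sum_(0 <= k < n) psi ^+ k) = 1 - psi ^+ n.
  move=> E; rewrite -(ler_pM2l (exprn_gt0 2 goldenV_gt0)) E -exprMn.
  by rewrite mulVf ?golden_neq0// expr1n; have := pos n; lra.
rewrite goldenV_sqr; elim: n => [|n IH]; first by rewrite big_geq// mulr0 subrr.
by rewrite big_nat_recr//= mulrDr IH exprS; ring.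
Qed.

Lemma sum_fib_weight_cvg m n :
  \sum_(m <= k < n) `|fib_weight k - psi ^+ 2| <= gam ^+ 2.
Proof.
by apply: le_trans (sum_goldenV m n); apply: ler_sum => k _; exact: fib_weight_cvg.
Qed.

End Fibonacci.

(** * Averages over [0, N) *)

Section EmpiricalMean.
Context {R : realType}.
Implicit Types (G : nat -> R) (N : nat).

Definition emean G N : R := (\sum_(0 <= n < N) G n) / N%:R.

Lemma emeanD G1 G2 N : emean (fun n => G1 n + G2 n) N = emean G1 N + emean G2 N.
Proof. by rewrite /emean big_split mulrDl. Qed.

Lemma emeanZ (c : R) G N : emean (fun n => c * G n) N = c * emean G N.
Proof. by rewrite /emean -mulr_sumr mulrA. Qed.

Lemma emean_cst (c : R) N : (0 < N)%N -> emean (fun=> c) N = c.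
Proof.
move=> N0; rewrite /emean sumr_const_nat subn0 -[c *+ _]mulr_natr mulfK//.
by rewrite pnatr_eq0 -lt0n.
Qed.

Lemma le_emean G1 G2 N : (forall n, (n < N)%N -> G1 n <= G2 n) ->
  emean G1 N <= emean G2 N.
Proof.
move=> le; rewrite /emean ler_wpM2r ?invr_ge0//.
by rewrite big_nat [leRHS]big_nat; apply: ler_sum => n /andP[_ /le].
Qed.

Lemma ler_norm_emean G N : `|emean G N| <= emean (fun n => `|G n|) N.
Proof.
rewrite /emean normrM normfV normr_nat ler_wpM2r ?invr_ge0//.
exact: ler_norm_sum.
Qed.

End EmpiricalMean.

(** * Averages over [0, F_k) *)

Section Average.
Context {R : realType}.
Implicit Types (G : nat -> R) (k n : nat).

Lemma sum_fibSS G k : \sum_(0 <= n < fib k.+2) G n =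
  \sum_(0 <= n < fib k.+1) G n + \sum_(0 <= m < fib k) G (fib k.+1 + m)%N.
Proof.
rewrite (@big_cat_nat _ _ _ (fib k.+1))//= ?leq_fib//; congr (_ + _).
rewrite -{1}[fib k.+1]add0n big_addn fibSS addKn.
by apply: eq_bigr => i _; rewrite addnC.
Qed.

Definition avg G k : R := emean G (fib k).

Lemma avgK G k : avg G k * (fib k)%:R = \sum_(0 <= n < fib k) G n.
Proof.
case: k => [|k]; last by rewrite /avg /emean divfK// fib_neq0.
by rewrite mulr0 big_geq.
Qed.

Lemma avg1 G : avg G 1 = G 0.
Proof. by rewrite /avg /emean big_nat1 divr1. Qed.

Lemma avg2 G : avg G 2 = G 0.
Proof. by rewrite /avg /emean big_nat1 divr1. Qed.

Lemma avgSS G k : avg G k.+2 =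
  (1 - fib_weight k) * avg G k.+1 +
  fib_weight k * avg (fun m => G (fib k.+1 + m)%N) k.
Proof.
apply: (mulIf (@fib_neq0 R k.+1)); rewrite avgK mulrDl.
rewrite [X in _ = _ + X](_ : _ = \sum_(0 <= m < fib k) G (fib k.+1 + m)%N); last first.
  rewrite -avgK mulrAC /fib_weight divfK ?fib_neq0// mulrC//.
rewrite [X in _ = X + _](_ : _ = \sum_(0 <= m < fib k.+1) G m); last first.
  rewrite -avgK mulrAC mulrBl /fib_weight divfK ?fib_neq0// mul1r mulrC.
  by rewrite fibSS natrD addrK.
exact: sum_fibSS.
Qed.

Lemma eq_avg G1 G2 k : (forall n, (n < fib k)%N -> G1 n = G2 n) ->
  avg G1 k = avg G2 k.
Proof.
by move=> E; congr (_ / _); apply: eq_big_nat => n /andP[_ /E].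
Qed.

Lemma avgD G1 G2 k : avg (fun n => G1 n + G2 n) k = avg G1 k + avg G2 k.
Proof. exact: emeanD. Qed.

Lemma avgZ c G k : avg (fun n => c * G n) k = c * avg G k.
Proof. exact: emeanZ. Qed.

Lemma avg_cst c k : avg (fun=> c) k.+1 = c.
Proof. by apply: emean_cst; rewrite fib_gt0. Qed.

Lemma le_avg G1 G2 k : (forall n, (n < fib k)%N -> G1 n <= G2 n) ->
  avg G1 k <= avg G2 k.
Proof. exact: le_emean. Qed.

Lemma ler_norm_avg G k : `|avg G k| <= avg (fun n => `|G n|) k.
Proof. exact: ler_norm_emean. Qed.

(** The difference of the two sides is the average of (G n - m)^2, with m the mean of G. *)
Lemma avg_sqr G k : avg G k.+1 ^+ 2 <= avg (fun n => G n ^+ 2) k.+1.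
Proof.
set m := avg G k.+1; rewrite -subr_ge0.
have -> : avg (fun n => G n ^+ 2) k.+1 - m ^+ 2 =
    avg (fun n => (G n ^+ 2 + (- (2 * m)) * G n) + m ^+ 2) k.+1.
  by rewrite avgD avgD avgZ avg_cst -/m; ring.
rewrite -[leLHS](avg_cst 0 k); apply: le_avg => n _.
rewrite (_ : _ + _ = (G n - m) ^+ 2) ?sqr_ge0//; ring.
Qed.

End Average.

(** * Mean and variance over [0, F_k) *)

Section ZRecursion.
Context {R : realType}.
Variables (f b : nat -> R).

(* For [f] additive along the Zeckendorf digits, [b j] is the value at [fib j];
   the leading digit of [fib k.+1 + m] is split off. *)
Definition zrec := f 0%N = 0 /\
  forall k m, (0 < k)%N -> (m < fib k)%N -> f (fib k.+1 + m)%N = b k.+1 + f m.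

Hypothesis fb : zrec.

Lemma avg_zrec (phi : R -> R) k : avg (phi \o f) k.+2 =
  (1 - fib_weight k) * avg (phi \o f) k.+1 +
  fib_weight k * avg (fun m => phi (b k.+1 + f m)) k.
Proof.
(* [zrec] says nothing at k = 0, but there the second average has weight 0. *)
rewrite avgSS; case: k => [|k]; first by rewrite fib_weight0 !mul0r.
congr (_ + _ * _); apply: eq_avg => m mk /=.
by rewrite fb.2.
Qed.

Definition mean k := avg f k.
Definition mean_diff k := mean k.+1 - mean k.
Definition variance k := avg (fun n => f n ^+ 2) k - mean k ^+ 2.

Lemma mean1 : mean 1 = 0. Proof. by rewrite /mean avg1 fb.1. Qed.
Lemma mean2 : mean 2 = 0. Proof. by rewrite /mean avg2 fb.1. Qed.

Lemma meanSS k : mean k.+2 =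
  (1 - fib_weight k) * mean k.+1 + fib_weight k * (b k.+1 + mean k).
Proof.
rewrite /mean (avg_zrec id); congr (_ + _).
case: k => [|k]; first by rewrite fib_weight0 !mul0r.
by rewrite avgD avg_cst.
Qed.

(** The recursion for the increments is of first order and contracts by a factor at most 1/2, so
    that a uniform bound on the b_j passes to them. *)
Lemma mean_diffS k : mean_diff k.+1 = fib_weight k * (b k.+1 - mean_diff k).
Proof. rewrite /mean_diff meanSS; ring. Qed.

(** Law of total variance: the two parts of [0, F_{k+2}) have weights 1 - w and w, the shift by
    b_{k+1} does not change the variance of the second, and the means of the parts differ by b_{k+1}
    - [mean_diff k]. *)
Lemma varianceSS k : variance k.+2 =
  (1 - fib_weight k) * variance k.+1 + fib_weight k * variance k +
  fib_weight k * (1 - fib_weight k) * (b k.+1 - mean_diff k) ^+ 2.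
Proof.
rewrite /variance (avg_zrec (fun x => x ^+ 2)) meanSS /mean_diff.
have [->|k0] := posnP k; first by rewrite fib_weight0; ring.
rewrite [avg (fun m => (_ + _) ^+ 2) k](_ : _ =
  b k.+1 ^+ 2 + 2 * b k.+1 * mean k + avg (fun n => f n ^+ 2) k); first by ring.
case: k k0 => // k _; rewrite /mean -avgZ -[X in _ = X + _ + _](avg_cst _ k) -!avgD.
apply: eq_avg => n _; ring.
Qed.

(* A Turan-Kubilius inequality; subtracting the square of the mean increment
   makes the induction go through. *)
Lemma variance_le_diff n : (0 < n)%N ->
  variance n <= \sum_(2 <= j < n.+1) b j ^+ 2 - mean_diff n ^+ 2 /\
  variance n.+1 <= \sum_(2 <= j < n.+1) b j ^+ 2 - mean_diff n ^+ 2.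
Proof.
elim: n => // -[_ _|n IH _].
  rewrite big_geq// /variance /mean_diff mean1 mean2 avg1 avg2 fb.1; lra.
have [//|] := IH; set S := \sum_(2 <= j < n.+2) _ => v1 v2.
rewrite big_nat_recr//= -/S.
have := varianceSS n.+1; rewrite (mean_diffS n.+1) => ->.
move: v1 v2; set v := variance _; set v' := variance _.
have := @fib_weight_ge0 R n.+1; have := @fib_weight_le R n.+1.
set w := fib_weight _; set d := mean_diff _; move: (b n.+2) => c w2 w0 v1 v2.
(* The new increment is w (c - d). Its square and the variance between the parts are each at most (c
   - d)^2 / 4, and their sum is absorbed by c^2 + d^2. *)
have cd : (w * (c - d)) ^+ 2 <= (c - d) ^+ 2 / 4.
  rewrite exprMn mulrC ler_wpM2l ?sqr_ge0//.
  by rewrite (_ : 4^-1 = (1 / 2) ^+ 2) ?ler_sqr ?nnegrE//; lra.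
have cd' : w * (1 - w) * (c - d) ^+ 2 <= (c - d) ^+ 2 / 4.
  rewrite [leRHS]mulrC ler_wpM2r ?sqr_ge0//.
  by have := sqr_ge0 (w - 1 / 2); nra.
have cd2 : (c - d) ^+ 2 / 2 <= c ^+ 2 + d ^+ 2.
  by have := sqr_ge0 (c + d); nra.
have vv : (1 - w) * v' + w * v <= S - d ^+ 2 by nra.
by have := sqr_ge0 (c - d); split; lra.
Qed.

Lemma variance_le n : (0 < n)%N ->
  variance n <= \sum_(2 <= j < n.+1) b j ^+ 2.
Proof. by move=> /variance_le_diff[+ _] => /le_trans -> //; rewrite gerBl sqr_ge0. Qed.

Local Notation lam := ((golden R)^-1 ^+ 2).

(** With the weight replaced by its limit [lam], the recursion [mean_diffS] telescopes. This ties
    the means to the partial sums of the b_j, up to an error that is summable when the b_j are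
    bounded. *)
Lemma mean_sum n : (0 < n)%N -> mean n.+1 + lam * mean n =
  lam * (\sum_(2 <= j < n.+1) b j) +
  \sum_(1 <= k < n) (fib_weight k - lam) * (b k.+1 - mean_diff k).
Proof.
elim: n => // -[_ _|n IH _]; first by rewrite !big_geq// mean1 mean2; ring.
have := IH isT => {}IH.
rewrite [\sum_(2 <= j < n.+3) _]big_nat_recr//=.
rewrite [\sum_(1 <= k < n.+2) _]big_nat_recr//= mulrDr addrACA -IH.
by rewrite meanSS /mean_diff; ring.
Qed.

Lemma mean_diff_le (c : R) : (forall j, (2 <= j)%N -> `|b j| <= c) ->
  forall k, (0 < k)%N -> `|mean_diff k| <= c.
Proof.
move=> bc; elim=> // -[_ _|k IH _].
  by rewrite /mean_diff mean1 mean2 subrr normr0; apply: le_trans (bc 2 _).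
rewrite mean_diffS normrM ger0_norm ?fib_weight_ge0//.
have := @fib_weight_ge0 R k.+1; have := @fib_weight_le R k.+1.
have := ler_normB (b k.+2) (mean_diff k.+1).
have := IH isT; have := bc k.+2 isT; have := normr_ge0 (b k.+2 - mean_diff k.+1).
by nra.
Qed.

Lemma mean_sum_err (c : R) m n : (0 < m)%N ->
  (forall j, (2 <= j)%N -> `|b j| <= c) ->
  \sum_(m <= k < n) `|(fib_weight k - lam) * (b k.+1 - mean_diff k)| <=
  2 * c * \sum_(m <= k < n) `|fib_weight k - lam|.
Proof.
move=> m0 bc; rewrite mulr_sumr big_nat [leRHS]big_nat.
apply: ler_sum => k /andP[mk _].
rewrite normrM mulrC ler_wpM2r//.
have := ler_normB (b k.+1) (mean_diff k).
have k0 : (0 < k)%N by exact: leq_trans mk.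
have := mean_diff_le bc k0; have := bc k.+1 k0; lra.
Qed.

Lemma mean_le (c : R) :
  (forall n, `|\sum_(2 <= j < n) b j| <= c) ->
  forall n, (0 < n)%N -> `|mean n| <= (3 + 4 * golden R ^+ 2) * c.
Proof.
move=> sc n n0.
have bc j : (2 <= j)%N -> `|b j| <= 2 * c.
  move=> j2; have := sc j.+1; have := sc j.
  rewrite big_nat_recr//=; set S := \sum_(_ <= _ < _) _ => h1 h2.
  by have := ler_normB (S + b j) S; rewrite addrAC subrr add0r; lra.
have E := mean_sum n0.
have := mean_sum_err n (ltnSn 0) bc.
have := ler_norm_sum (index_iota 1 n)
   (fun k => (fib_weight k - lam) * (b k.+1 - mean_diff k)) xpredT.
have := @sum_fib_weight_cvg R 1 n.
move: E; set e := \sum_(1 <= k < n) _ * _; set e' := \sum_(1 <= k < n) `|_ - _|.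
set e1 := \sum_(1 <= k < n) `|_| => E e'le ele e1le.
have := sc n.+1; set s := \sum_(2 <= j < n.+1) b j => sle.
have dle := mean_diff_le bc n0.
have c0 : 0 <= c by apply: le_trans (sc 0%N).
have lam0 : 0 < lam by rewrite exprn_gt0// goldenV_gt0.
have lam1 : lam <= 1 by rewrite exprn_ile1 ?(ltW goldenV_gt0) ?(ltW goldenV_lt1).
(* The three terms on the right are at most c, 4 gam^2 c and 2 c in absolute value, whence the
   constant 3 + 4 gam^2. *)
have dE : (1 + lam) * mean n = lam * s + e - mean_diff n.
  by rewrite -E /mean_diff; ring.
have le1 : `|mean n| <= `|(1 + lam) * mean n|.
  have h1 : 0 <= 1 + lam by lra.
  rewrite [leRHS]normrM (ger0_norm h1).
  by rewrite mulrDl mul1r lerDl mulr_ge0// ltW.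
apply: (le_trans le1); rewrite dE.
have le2 := ler_normB (lam * s + e) (mean_diff n).
have le3 := ler_normD (lam * s) e.
have le4 : `|lam * s| <= c.
  by rewrite normrM gtr0_norm//; have := normr_ge0 s; nra.
have le5 : 2 * (2 * c) * e' <= 2 * (2 * c) * golden R ^+ 2 by rewrite ler_wpM2l//; lra.
lra.
Qed.

End ZRecursion.

(** * Convergence criteria and construction of distribution functions *)

Section RealSequences.
Context {R : realType}.
Implicit Types (u : nat -> R).

Lemma cvgn_distP u (l : R) : u n @[n --> \oo] --> l <->
  forall e : R, 0 < e -> exists N, forall n, (N <= n)%N -> `|u n - l| <= e.
Proof.
split=> [/cvgrPdist_le ul e e0|ul].
  by have [N _ uN] := ul e e0; exists N => n Nn; rewrite distrC; exact: uN.
apply/cvgrPdist_le => e e0; have [N uN] := ul e e0.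
by exists N => // n Nn /=; rewrite distrC; exact: uN.
Qed.

Lemma cvgn_cauchyP u : cvgn u <->
  forall e : R, 0 < e -> exists N, forall m n, (N <= m)%N -> (N <= n)%N ->
    `|u m - u n| <= e.
Proof.
split=> [/cvg_ex[l /cvgn_distP ul] e e0|uc].
  have [|N uN] := ul (e / 2); first lra.
  exists N => m n /uN um /uN un.
  by have := ler_distD l (u m) (u n); rewrite [`|l - _|]distrC; lra.
apply/cauchy_cvgP/cauchy_exP => e e0.
have [|N uN] := uc (e / 2); first lra.
exists (u N); exists N => // n Nn; rewrite /ball/=.
by have := uN N n (leqnn _) Nn; lra.
Qed.

Lemma cumulativeBounded_ex (F : R -> R) :
  nondecreasing F -> right_continuous F ->
  F @ -oo --> (0 : R) -> F @ +oo --> (1 : R) ->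
  exists G : cumulativeBounded (0 : R) (1 : R), G =1 F.
Proof.
move=> nd rc F0 F1.
pose m1 := isCumulative.Build R _ R F nd rc.
pose m2 := isCumulativeBounded.Build R 0 1 F F0 F1.
pose G : cumulativeBounded (0 : R) (1 : R) := HB.pack F m1 m2.
by exists G.
Qed.

End RealSequences.

(** * Empirical distribution functions *)

Section EmpiricalCdf.
Context {R : realType}.
Implicit Types (f g : nat -> R) (N : nat) (y : R).

Definition ecdf f N y : R := emean (fun n => (f n <= y)%R%:R) N.

Lemma ecdfE f N y : #|[pred n : 'I_N | f n <= y]|%:R / N%:R = ecdf f N y.
Proof.
by rewrite /ecdf /emean -sum1_card big_mkcond/= natr_sum big_mkord.
Qed.

Lemma ecdf_ge0 f N y : 0 <= ecdf f N y.
Proof. by rewrite divr_ge0// sumr_ge0. Qed.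

Lemma ecdf_le1 f N y : ecdf f N y <= 1.
Proof.
case: N => [|N]; first by rewrite /ecdf /emean invr0 mulr0.
rewrite /ecdf /emean ler_pdivrMr ?ltr0n// mul1r.
apply: (@le_trans _ _ (\sum_(0 <= n < N.+1) 1)).
  by apply: ler_sum => n _; rewrite lern1 leq_b1.
by rewrite sumr_const_nat subn0.
Qed.

Lemma le_ecdf f N x y : x <= y -> ecdf f N x <= ecdf f N y.
Proof.
move=> xy; rewrite /ecdf /emean ler_wpM2r ?invr_ge0//.
apply: ler_sum => n _; rewrite ler_nat; case: (boolP (f n <= x)) => // /le_trans.
by move=> /(_ _ xy) ->.
Qed.

Lemma ecdf_eq0 f N y : (forall n, (n < N)%N -> y < f n) -> ecdf f N y = 0.
Proof.
move=> yf; rewrite /ecdf /emean big_nat big1 ?mul0r// => n /andP[_ /yf].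
by rewrite ltNge => /negbTE ->.
Qed.

Lemma ecdf_eq1 f N y : (0 < N)%N -> (forall n, (n < N)%N -> f n <= y) ->
  ecdf f N y = 1.
Proof.
move=> N0 fy; rewrite /ecdf /emean (eq_big_nat _ _ (F2 := fun=> 1)).
  by rewrite sumr_const_nat subn0 divff// pnatr_eq0 -lt0n.
by move=> n /andP[_ /fy ->].
Qed.

(** Chebyshev's inequality: wherever f n <= y but g n > y + eta, the squared difference is at least
    eta^2. *)
Lemma ecdf_markov f g N y (c eta : R) : 0 <= c -> 0 < eta ->
  \sum_(0 <= n < N) (f n - g n) ^+ 2 <= c * N%:R ->
  ecdf f N y <= ecdf g N (y + eta) + c / eta ^+ 2.
Proof.
move=> c0 eta0 fg.
have c'0 : 0 <= c / eta ^+ 2 by rewrite divr_ge0// sqr_ge0.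
case: N fg => [_|N fg].
  by rewrite /ecdf /emean !big_geq// mul0r add0r.
have N0 : 0 < N.+1%:R :> R by [].
rewrite -(ler_pM2r N0) mulrDl /ecdf /emean !divfK ?gt_eqF//.
apply: (@le_trans _ _ (\sum_(0 <= n < N.+1) ((g n <= y + eta)%R%:R +
    (f n - g n) ^+ 2 / eta ^+ 2))); last first.
  by rewrite big_split/= lerD2l -mulr_suml mulrAC ler_wpM2r ?invr_ge0 ?sqr_ge0.
apply: ler_sum => n _.
have q0 : 0 <= (f n - g n) ^+ 2 / eta ^+ 2 by rewrite divr_ge0// sqr_ge0.
case: (leP (f n) y) => fy; last by rewrite addr_ge0.
case: (leP (g n) (y + eta)) => gy; first by rewrite lerDl.
rewrite add0r ler_pdivlMr ?exprn_gt0// mul1r -[leRHS]sqrrN.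
by rewrite ler_sqr ?nnegrE; lra.
Qed.

End EmpiricalCdf.

(** * Functions with prescribed values at the Fibonacci numbers *)

Section ZRecursionExtra.
Context {R : realType}.
Implicit Types (f b : nat -> R).

(** Induction by removal of the leading Zeckendorf digit. *)
Lemma zrec_ind (P : nat -> Prop) : P 0%N ->
  (forall k m, (0 < k)%N -> (m < fib k)%N -> P m -> P (fib k.+1 + m)%N) ->
  forall n, P n.
Proof.
move=> P0 PS n; have : (n < fib n.+2)%N by have := leq_fibS n.+2; rewrite !ltnS.
move: (n.+2) => k; elim/ltn_ind: k n => k IH n nk.
case: k IH nk => [|[|[|k]]] IH nk; first by [].
- by move: nk; case: n.
- by move: nk; case: n.
- have [nk'|nk'] := ltnP n (fib k.+2); first exact: (IH k.+2).
  have nk1 : (n - fib k.+2 < fib k.+1)%N by rewrite ltn_subLR// -fibSS.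
  rewrite -(subnKC nk'); apply: PS => //.
  by apply: (IH k.+1) => //; lia.
Qed.

(** Greedy expansion using only indices from 2 to k - 1. The bound k makes the recursion structural,
    and once n < F_k the value no longer depends on it. *)
Fixpoint zrec_approx b k n : R :=
  if k is k'.+1 then
    if (k' < 2)%N || (n < fib k')%N then zrec_approx b k' n
    else b k' + zrec_approx b k' (n - fib k')%N
  else 0.

Lemma zrec_approxE b k n : zrec_approx b k.+1 n =
  if (k < 2)%N || (n < fib k)%N then zrec_approx b k n
  else b k + zrec_approx b k (n - fib k)%N.
Proof. by []. Qed.

Arguments zrec_approx : simpl never.

Lemma zrec_approxS b k n : (n < fib k)%N ->
  zrec_approx b k.+1 n = zrec_approx b k n.
Proof. by rewrite zrec_approxE => ->; rewrite orbT. Qed.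

Lemma zrec_approx_stable b k j n : (n < fib k)%N -> (k <= j)%N ->
  zrec_approx b j n = zrec_approx b k n.
Proof.
move=> nk; elim: j => [|j IH]; first by rewrite leqn0 => /eqP <-.
rewrite leq_eqVlt => /predU1P[<-//|]; rewrite ltnS => kj.
by rewrite zrec_approxS ?IH// (leq_trans nk)// leq_fib.
Qed.

(** This supplies the function that keeps only the low digits of a given one. The bound n + 2
    suffices in the expansion of n because n < F_{n+2}. *)
Lemma zrec_exists b : exists f, zrec f b.
Proof.
have nf n : (n < fib n.+2)%N by have := leq_fibS n.+2; rewrite !ltnS.
exists (fun n => zrec_approx b n.+2 n); split=> // k m k0 mk.
have mk1 : (m < fib k.+1)%N by rewrite (leq_trans mk)// leq_fib.
have mk2 : (fib k.+1 + m < fib k.+2)%N by rewrite fibSS ltn_add2l.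
have st : zrec_approx b (fib k.+1 + m).+2 (fib k.+1 + m) =
    zrec_approx b k.+2 (fib k.+1 + m).
  have [h|h] := leqP k.+2 (fib k.+1 + m).+2.
    exact: zrec_approx_stable.
  by apply/esym/zrec_approx_stable => //; apply: ltnW.
rewrite st zrec_approxE addKn [(_ < fib _)%N]ltnNge leq_addr orbF.
case: k k0 mk mk1 mk2 st => // k _ mk mk1 mk2 _; rewrite ltnNge/=; congr (_ + _).
have [h|h] := leqP k.+2 m.+2; first by rewrite -(zrec_approx_stable b mk1 h).
by apply: zrec_approx_stable => //; apply: ltnW.
Qed.

Lemma zrecB f1 f2 b1 b2 : zrec f1 b1 -> zrec f2 b2 ->
  zrec (fun n => f1 n - f2 n) (fun j => b1 j - b2 j).
Proof.
move=> [f10 f1S] [f20 f2S]; split=> [|k m k0 mk]; first by rewrite f10 f20 subrr.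
by rewrite f1S// f2S//; ring.
Qed.

(** An expansion uses each index at most once, so the sum of the |b_j| over j < K is a bound. *)
Lemma zrec_bounded f b K : zrec f b -> (forall j, (K <= j)%N -> b j = 0) ->
  exists C, forall n, `|f n| <= C.
Proof.
move=> [f0 fS] bK.
suff H : forall n k, (n < fib k)%N -> `|f n| <= \sum_(0 <= j < k) `|b j|.
  exists (\sum_(0 <= j < K) `|b j|) => n.
  have nk : (n < fib (K + n.+2))%N.
    by have := leq_fibS (K + n.+2); lia.
  apply: le_trans (H _ _ nk) _; rewrite (@big_cat_nat _ _ _ K)//= ?leq_addr//.
  rewrite [X in _ + X]big_nat [X in _ + X]big1 ?addr0// => i /andP[/bK -> _].
  by rewrite normr0.
elim/zrec_ind => [k _|k m k0 mk IH j jk]; first by rewrite f0 normr0 sumr_ge0.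
have kj : (k.+1 < j)%N.
  rewrite ltnNge; apply/negP => /leq_fib; have := jk; lia.
rewrite fS//; apply: le_trans (ler_normD _ _) _.
have := IH _ mk.
rewrite (@big_cat_nat _ _ _ k.+1 0 j)//=; last exact: ltnW.
rewrite [\sum_(0 <= i < k.+1) _]big_nat_recr//= [\sum_(k.+1 <= i < j) _]big_ltn//.
have : 0 <= \sum_(k.+2 <= i < j) `|b i| by apply: sumr_ge0.
have := normr_ge0 (b k); lra.
Qed.

End ZRecursionExtra.

(** * From Zeckendorf digits to the recursion *)

Section ZAdditive.
Context {R : realType}.
Variable (f : nat -> R).
Hypothesis f_add : Z_additive f.

(** The digits of m < F_k all have index below k, so adding the digit k + 1 to them creates no two
    adjacent digits and gives the representation of F_{k+1} + m. *)
Lemma Z_additive_zrec : zrec f (f \o fib).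
Proof.
have [f0 fD] := f_add; split=> // k m k0 mk.
have [d [[d1 d2 d3] _]] := zeckendorf_exists_unique m.
have dk i : (k <= i)%N -> d i = false.
  move=> ki; apply/negP => di; have /andP[i2 im] := d1 _ di.
  have : (fib i <= m)%N.
    rewrite d3 (big_cat_nat _ (n := i))//=; last exact: ltnW.
    by rewrite [X in (_ <= _ + X)%N]big_ltn// di mul1n addnCA leq_addr.
  by have := leq_fib ki; lia.
pose e i := d i || (i == k.+1).
have km : (k.+1 < (fib k.+1 + m).+2)%N by have := leq_fibS k.+1; lia.
(* The generality in V lets one statement serve both the sum of Fibonacci numbers in nat and the sum
   of values of f in R. *)
have split_sum (V : nmodType) (F : nat -> V) :
    (forall i, ~~ e i -> F i = 0) ->
    \sum_(2 <= i < (fib k.+1 + m).+2) F i =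
    F k.+1 + \sum_(2 <= i < m.+2) (if d i then F i else 0).
  move=> Fe.
  have -> : \sum_(2 <= i < m.+2) (if d i then F i else 0) =
      \sum_(2 <= i < (fib k.+1 + m).+2) (if d i then F i else 0).
    rewrite [RHS](@big_cat_nat _ _ _ m.+2)//=; last by lia.
    rewrite [X in _ + X]big_nat [X in _ + X]big1 ?addr0// => i /andP[mi _].
    by case: ifPn => // /d1/andP[_ im]; have := leq_trans im mi; rewrite ltnn.
  rewrite (bigD1_seq k.+1)/= ?iota_uniq ?mem_index_iota ?km ?andbT//.
  congr (_ + _); rewrite [RHS](bigD1_seq k.+1)/= ?iota_uniq ?mem_index_iota ?km ?andbT//.
  rewrite dk// add0r; apply: eq_bigr => i ik; case: ifPn => // di.
  by apply: Fe; rewrite /e negb_or di.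
have ze : zeckendorf (fib k.+1 + m) e.
  split.
  - move=> i /orP[/d1|/eqP ->]; lia.
  - move=> i /orP[di|/eqP ->]; apply/negbTE; rewrite negb_or.
      by rewrite d2//= eqSS; apply/negP => /eqP ik; move: di; rewrite ik dk.
    have -> : d k.+2 = false by apply: dk; lia.
    by apply/eqP; lia.
  - rewrite (split_sum _ (fun i => (e i * fib i)%N)); last first.
      by move=> i /negbTE ->.
    rewrite /e eqxx orbT mul1n; congr (_ + _)%N; rewrite [LHS]d3.
    by apply: eq_bigr => i _; case: (d i).
rewrite (fD _ _ ze) (split_sum _ (fun i => f (e i * fib i)%N)); last first.
  by move=> i /negbTE ->.
rewrite /e eqxx orbT mul1n /=; congr (_ + _).
rewrite (fD m d)//; apply: eq_bigr => i _.
by case: (d i); rewrite /= ?mul0n ?f0.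
Qed.

End ZAdditive.

(** * Approximation in L^2 by functions of finitely many digits *)

Section TailApproximation.
Context {R : realType}.
Implicit Types (f h a : nat -> R).

(** Bounds on the segments [0, F_k) pass to all [0, N) at the cost of a factor 2: if F_k is the
    first Fibonacci number >= N and k >= 2, then F_{k-2} <= F_{k-1} < N. *)
Lemma fib_cover N : (0 < N)%N ->
  exists k, [/\ (0 < k)%N, (N <= fib k)%N & (fib k <= 2 * N)%N].
Proof.
move=> N0; have ex : exists k, (N <= fib k)%N.
  by exists N.+1; have := leq_fibS N.+1; lia.
case: (ex_minnP ex) => -[|[|k]] Nk kmin.
- by move: Nk; rewrite leqNgt N0.
- by exists 1%N; split => //; rewrite (@leq_trans 1)//; lia.
- exists k.+2; split => //; rewrite fibSS.
  have : (fib k.+1 < N)%N by rewrite ltnNge; apply/negP => /kmin; rewrite ltnn.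
  have := leq_fib (leqnSn k); lia.
Qed.

Definition head_part a K j : R := if (j < K)%N then a j else 0.

Lemma sum_tail a K n : (2 <= K)%N ->
  \sum_(2 <= j < n) (a j - head_part a K j) =
  \sum_(2 <= j < maxn n K) a j - \sum_(2 <= j < K) a j.
Proof.
move=> K2; rewrite /head_part; have [nK|Kn] := leqP n K.
  rewrite subrr big_nat big1// => j /andP[_ jn].
  by rewrite (leq_trans jn nK) subrr.
rewrite !(@big_cat_nat _ _ _ K 2 n)//= ?(ltnW Kn)//.
rewrite [X in X + _ = _]big_nat [X in X + _ = _]big1 ?add0r; last first.
  by move=> j /andP[_ ->]; rewrite subrr.
rewrite addrAC subrr add0r; apply: eq_big_nat => j /andP[Kj _].
by rewrite ltnNge Kj subr0.
Qed.

(** The difference f - h carries only the tail of the a_j. Its mean is small by [mean_le] and its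
    variance by [variance_le], hence so is its second moment. *)
Lemma zrec_tail_small f a (e : R) : zrec f a ->
  cvgn (fun n => \sum_(2 <= j < n) a j) ->
  cvgn (fun n => \sum_(2 <= j < n) a j ^+ 2) -> 0 < e ->
  exists K h, zrec h (head_part a K) /\
    forall N, \sum_(0 <= n < N) (f n - h n) ^+ 2 <= e * N%:R.
Proof.
move=> fa /cvgn_cauchyP a1 /cvgn_cauchyP a2 e0.
pose C : R := 3 + 4 * golden R ^+ 2.
have C0 : 0 < C by rewrite /C; have := sqr_ge0 (golden R); lra.
(* C is the constant of [mean_le], so the squared mean is at most (C s)^2 = e / 4. The variance
   takes another e / 4, and [fib_cover] doubles the total. *)
pose s := Num.sqrt (e / 4) / C.
have s0 : 0 < s by rewrite divr_gt0// sqrtr_gt0; lra.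
have Cs : (C * s) ^+ 2 = e / 4.
  by rewrite /s mulrCA divff ?gt_eqF// mulr1 sqr_sqrtr//; lra.
have [K1 aK1] := a1 s s0.
have [|K2 aK2] := a2 (e / 4); first lra.
pose K := maxn 2 (maxn K1 K2).
have K_2 : (2 <= K)%N by rewrite leq_maxl.
have [h ha] := @zrec_exists R (head_part a K); exists K, h; split => //.
have ga := zrecB fa ha; set g := (fun n => f n - h n) in ga.
have sg n : `|\sum_(2 <= j < n) (a j - head_part a K j)| <= s.
  by rewrite sum_tail//; apply: aK1; rewrite /K; lia.
have sg2 n : \sum_(2 <= j < n) (a j - head_part a K j) ^+ 2 <= e / 4.
  rewrite (_ : \sum_(_ <= _ < _) _ =
      \sum_(2 <= j < n) (a j ^+ 2 - head_part (fun j => a j ^+ 2) K j)); last first.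
    apply: eq_bigr => j _; rewrite /head_part; case: ifP => _.
      by rewrite !subrr expr0n.
    by rewrite !subr0.
  rewrite sum_tail//; apply: le_trans (ler_norm _) _.
  by apply: aK2; rewrite /K; lia.
have ag k : (0 < k)%N -> avg (fun n => g n ^+ 2) k <= e / 2.
  move=> k0; have := variance_le ga k0; rewrite /variance.
  have := sg2 k.+1; have := mean_le ga sg k0; rewrite -/C => m1 m2 m3.
  have : mean g k ^+ 2 <= (C * s) ^+ 2.
    by rewrite -real_normK ?num_real// ler_sqr ?nnegrE// mulr_ge0// ltW.
  by rewrite Cs; lra.
move=> N; have [->|N0] := posnP N; first by rewrite big_geq// mulr0.
have [k [k0 Nk kN]] := fib_cover N0.
apply: (@le_trans _ _ (\sum_(0 <= n < fib k) g n ^+ 2)).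
  rewrite [leRHS](@big_cat_nat _ _ _ N)//= lerDl sumr_ge0// => i _.
  exact: sqr_ge0.
rewrite -avgK; apply: (@le_trans _ _ (e / 2 * (fib k)%:R)).
  by rewrite ler_wpM2r// ag.
rewrite -mulrA ler_wpM2l ?(ltW e0)//.
by move: kN; rewrite -(ler_nat R) natrM; lra.
Qed.

End TailApproximation.

(** * Natural densities of level sets *)

Section Density.
Context {R : realType}.

Lemma natr_div_small (c e : R) : 0 < e ->
  exists N0 : nat, (0 < N0)%N /\ forall N, (N0 <= N)%N -> c / N%:R <= e.
Proof.
move=> e0; exists (Num.truncn (c / e)).+1; split => // N NN.
have N0 : 0 < N%:R :> R by rewrite ltr0n (leq_trans _ NN).
rewrite ler_pdivrMr// mulrC -ler_pdivrMr// ltW//.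
by rewrite (lt_le_trans (truncnS_gt _))// ler_nat.
Qed.

(* For [K <= j] the values at the Fibonacci numbers satisfy the Fibonacci
   recurrence; subtracting the right multiple of the identity leaves its
   decaying solution. *)
Lemma fib_density (H : nat -> R) K : H 0%N = 0 ->
  (forall j m, (K <= j)%N -> (m <= fib j)%N ->
    H (fib j.+1 + m)%N = H (fib j.+1) + H m) ->
  cvgn (fun N => H N / N%:R).
Proof.
move=> H0 HD; pose psi := (golden R)^-1.
have psi0 : 0 < psi := goldenV_gt0.
(* This slope is chosen so that E (F_{K+1}) = - psi E (F_K), that is, E has no component along the
   growing solution. *)
pose al := (H (fib K.+1) + psi * H (fib K)) / ((fib K.+1)%:R + psi * (fib K)%:R).
pose E N := H N - al * N%:R.
have ED j m : (K <= j)%N -> (m <= fib j)%N ->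
    E (fib j.+1 + m)%N = E (fib j.+1) + E m.
  by move=> Kj mj; rewrite /E HD// natrD; ring.
have den0 : 0 < (fib K.+1)%:R + psi * (fib K)%:R.
  by rewrite ltr_pwDl ?ltr0n ?fib_gt0// mulr_ge0// ltW.
have EK : E (fib K.+1) = - psi * E (fib K).
  have := divfK (lt0r_neq0 den0) (H (fib K.+1) + psi * H (fib K)).
  by rewrite -/al /E => h; lra.
have Epow i : E (fib (K + i)) = (- psi) ^+ i * E (fib K) /\
    E (fib (K + i).+1) = (- psi) ^+ i.+1 * E (fib K).
  elim: i => [|i [IH1 IH2]]; first by rewrite addn0 expr0 mul1r expr1 EK.
  rewrite addnS; split => //; rewrite fibSS ED ?leq_addr// IH1 IH2 -mulrDl.
  congr (_ * _); rewrite !exprS.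
  have p2 : psi * psi = 1 - psi by rewrite -expr2 goldenV_sqr.
  transitivity ((1 - psi) * (- psi) ^+ i); first by ring.
  by rewrite -p2; ring.
pose B := \sum_(0 <= n < fib K.+1) `|E n|.
have BE n : (n < fib K.+1)%N -> `|E n| <= B.
  move=> nK; rewrite /B (bigD1_seq n)/= ?iota_uniq ?mem_index_iota//.
  by rewrite lerDl sumr_ge0.
(* Each leading Fibonacci number split off from n costs one term of a geometric series in psi; what
   remains below F_{K+1} costs at most B. Hence E is bounded. *)
have bound i n : (n < fib (K + i).+1)%N ->
    `|E n| <= B + `|E (fib K)| * \sum_(0 <= l < i.+1) psi ^+ l.
  have nn m : 0 <= \sum_(0 <= l < m) psi ^+ l.
    by apply: sumr_ge0 => l _; rewrite exprn_ge0// ltW.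
  elim/ltn_ind: i n => i IH n nK.
  have [nK'|nK'] := ltnP n (fib K.+1).
    by apply: le_trans (BE _ nK') _; rewrite lerDl mulr_ge0.
  case: i IH nK => [|i] IH nK; first by move: nK; rewrite addn0 ltnNge nK'.
  have step m : (m < fib (K + i))%N ->
      `|E m| <= B + `|E (fib K)| * \sum_(0 <= l < i.+1) psi ^+ l.
    by move=> mi; apply: IH => //; rewrite (leq_trans mi)// leq_fib.
  have [nKi|nKi] := ltnP n (fib (K + i).+1).
    apply: le_trans (IH i (ltnSn _) n nKi) _.
    by rewrite [in leRHS]big_nat_recr//= mulrDr addrA lerDl mulr_ge0// exprn_ge0// ltW.
  have mi : (n - fib (K + i).+1 < fib (K + i))%N.
    by rewrite ltn_subLR// -fibSS -addnS.
  rewrite -(subnKC nKi) ED ?leq_addr//; last exact: ltnW.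
  apply: le_trans (ler_normD _ _) _.
  rewrite (Epow i).2 normrM normrX normrN (gtr0_norm psi0).
  by rewrite [in leRHS]big_nat_recr//= mulrDr; have := step _ mi; lra.
pose D := B + `|E (fib K)| * golden R ^+ 2.
have ED' n : `|E n| <= D.
  have nk : (n < fib (K + n.+1).+1)%N by have := leq_fibS (K + n.+1).+1; lia.
  apply: le_trans (bound _ _ nk) _; rewrite lerD2l ler_wpM2l//.
  exact: sum_goldenV.
apply/cvg_ex; exists al; apply/cvgn_distP => e e0.
have [N0 [N00 N0e]] := natr_div_small D e0.
exists N0 => N NN; have Np : 0 < N%:R :> R by rewrite ltr0n (leq_trans N00).
have -> : H N / N%:R - al = E N / N%:R.
  by rewrite /E mulrBl mulfK ?gt_eqF.
rewrite normrM normfV [ `|N%:R|]gtr0_norm//.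
by apply: le_trans (N0e N NN); rewrite ler_wpM2r ?invr_ge0 ?ler0n.
Qed.

(** Adding F_{j+1} with j >= K leaves h unchanged, so the number of n < N with h n <= y is additive
    in the sense of [fib_density]. *)
Lemma ecdf_head_cvg (h a : nat -> R) K y : zrec h (head_part a K) ->
  cvgn (fun N => ecdf h N y).
Proof.
move=> hK; apply: (@fib_density
    (fun N => \sum_(0 <= n < N) (h n <= y)%R%:R) (maxn 1 K)).
  by rewrite big_geq.
move=> j m; rewrite geq_max => /andP[j1 Kj] mj.
rewrite (@big_cat_nat _ _ _ (fib j.+1))//= ?leq_addr//; congr (_ + _).
rewrite -{1}[fib j.+1]add0n big_addn addKn; apply: eq_big_nat => i /andP[_ im].
rewrite addnC hK.2 ?(leq_trans im)// /head_part ltnNge ltnW ?add0r//.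
Qed.

End Density.

(** * Convergence of both series gives a limit distribution *)

Section Sufficiency.
Context {R : realType}.
Variables (f a : nat -> R).
Hypothesis fa : zrec f a.
Hypothesis a1 : cvgn (fun n => \sum_(2 <= j < n) a j).
Hypothesis a2 : cvgn (fun n => \sum_(2 <= j < n) a j ^+ 2).

(** One passes from f to h at N, then from N to M for h, whose empirical distribution functions
    converge, and back to f at M. Each change of function costs a shift of eta / 2 and an error e /
    4. *)
Lemma ecdf_almost_cauchy y (eta e : R) : 0 < eta -> 0 < e ->
  exists N0, forall N M, (N0 <= N)%N -> (N0 <= M)%N ->
    ecdf f N y <= ecdf f M (y + eta) + e.
Proof.
move=> eta0 e0; pose et := eta / 2; have et0 : 0 < et by rewrite /et; lra.
pose c := e / 4 * et ^+ 2.
have c0 : 0 < c by rewrite mulr_gt0 ?exprn_gt0//; lra.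
have [K [h [hK fh]]] := zrec_tail_small fa a1 a2 c0.
have hf N : \sum_(0 <= n < N) (h n - f n) ^+ 2 <= c * N%:R.
  apply: le_trans (fh N); rewrite le_eqVlt; apply/orP; left; apply/eqP.
  by apply: eq_bigr => n _; rewrite -sqrrN opprB.
have cE : c / et ^+ 2 = e / 4 by rewrite /c mulfK// gt_eqF// exprn_gt0.
have /cvgn_cauchyP hc := @ecdf_head_cvg R h a K (y + et) hK.
have [|N0 hN0] := hc (e / 2); first lra.
exists N0 => N M NN NM.
have := ecdf_markov y (ltW c0) et0 (fh N).
have := ecdf_markov (y + et) (ltW c0) et0 (hf M).
rewrite cE -addrA (_ : et + et = eta); last by rewrite /et; lra.
by have := hN0 N M NN NM; rewrite ler_norml => /andP[_]; lra.
Qed.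

(** A bounded h lies within mean square distance 1 of f on every [0, N), so Chebyshev's inequality
    controls the tails. *)
Lemma ecdf_tight (e : R) : 0 < e -> exists A, forall N, (0 < N)%N ->
  ecdf f N (- A) <= e /\ 1 - e <= ecdf f N A.
Proof.
move=> e0; have [K [h [hK fh]]] := zrec_tail_small fa a1 a2 ltr01.
have hf N : \sum_(0 <= n < N) (h n - f n) ^+ 2 <= 1 * N%:R.
  apply: le_trans (fh N); rewrite le_eqVlt; apply/orP; left; apply/eqP.
  by apply: eq_bigr => n _; rewrite -sqrrN opprB.
have [C hC] : exists C, forall n, `|h n| <= C.
  by apply: (zrec_bounded (K := K) hK) => j Kj; rewrite /head_part ltnNge Kj.
(* Then e eta^2 = e + 2 + 1/e >= 1. *)
pose eta := 1 + e^-1.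
have eV0 : 0 < e^-1 by rewrite invr_gt0.
have eta0 : 0 < eta by rewrite /eta; lra.
have etae : 1 / eta ^+ 2 <= e.
  rewrite ler_pdivrMr ?exprn_gt0// /eta sqrrD.
  have ee : e * e^-1 = 1 by rewrite divff ?gt_eqF.
  rewrite (_ : e * _ = e + 2 * (e * e^-1) + (e * e^-1) * e^-1); last by ring.
  by rewrite ee; lra.
exists (C + 1 + eta) => N N0; split.
  have := ecdf_markov (- (C + 1 + eta)) ler01 eta0 (fh N).
  rewrite (@ecdf_eq0 _ h); first by lra.
  move=> n _; have := hC n; rewrite ler_norml => /andP[+ _]; lra.
have := ecdf_markov (C + 1) ler01 eta0 (hf N).
rewrite (@ecdf_eq1 _ h)//; first by lra.
move=> n _; have := hC n; rewrite ler_norml => /andP[_]; lra.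
Qed.

(** The infimum of this set is the infimum over z > y of the limsup of [ecdf f N z]. Taking z > y
    makes it right-continuous in y. *)
Let upper y : set R := [set x | exists2 z, y < z &
  exists N0, forall N, (N0 <= N)%N -> ecdf f N z <= x].

Let upper_lb y : lbound (upper y) 0.
Proof.
by move=> x [z _ [N0 /(_ N0 (leqnn _))]]; apply: le_trans; exact: ecdf_ge0.
Qed.

Let upper1 y : upper y 1.
Proof. by exists (y + 1); rewrite ?ltrDl//; exists 0%N => N _; exact: ecdf_le1. Qed.

Let has_inf_upper y : has_inf (upper y).
Proof. by split; [exists 1|exists 0; exact: upper_lb]. Qed.

Let G y : R := inf (upper y).

Let G_le y x : upper y x -> G y <= x.
Proof. by move=> yx; apply: ge_inf => //; exists 0; exact: upper_lb. Qed.

Let G_lt y (e : R) : 0 < e -> exists2 x, upper y x & x < G y + e.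
Proof. by move=> e0; exact: inf_adherent. Qed.

Let G_nd : nondecreasing G.
Proof.
move=> y y' yy'; apply: lb_le_inf; first by exists 1.
by move=> x [z y'z zx]; apply: G_le; exists z => //; exact: le_lt_trans y'z.
Qed.

Let G_rc : right_continuous G.
Proof.
move=> y; apply/cvgrPdist_le => e e0.
have [x [z yz zx] xe] := G_lt y e0.
near=> t; rewrite distrC ger0_norm; last first.
  by rewrite subr_ge0 G_nd//; near: t; exact: nbhs_right_ge.
rewrite lerBlDl (le_trans _ (ltW xe))// G_le//; exists z; last exact: zx.
by near: t; exact: nbhs_right_lt.
Unshelve. all: by end_near. Qed.

Let G_Ny : G @ -oo --> (0 : R).
Proof.
apply/cvgrPdist_le => e e0; have [A fA] := ecdf_tight e0.
exists (- A); split; first exact: num_real.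
move=> t tA /=; rewrite sub0r normrN ger0_norm; last first.
  by apply: lb_le_inf; [exists 1|exact: upper_lb].
apply: G_le; exists (- A) => //.
by exists 1%N => N N1; exact: (fA N N1).1.
Qed.

Let G_y : G @ +oo --> (1 : R).
Proof.
apply/cvgrPdist_le => e e0; have [A fA] := ecdf_tight e0.
exists A; split; first exact: num_real.
move=> t At /=; rewrite ger0_norm; last by rewrite subr_ge0 G_le.
rewrite lerBlDl -lerBlDr; apply: lb_le_inf; first by exists 1.
move=> x [z tz [N0 fx]]; apply: le_trans (fx N0.+1 (leqnSn _)).
apply: le_trans (fA N0.+1 _).2 _ => //; apply: le_ecdf.
exact: ltW (lt_trans At tz).
Qed.

Lemma zrec_distribution_exists : exists F : cumulativeBounded (0 : R) (1 : R),
  has_distribution_function f F.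
Proof.
have [F FG] := cumulativeBounded_ex G_nd G_rc G_Ny G_y.
exists F => y Fy.
have -> : (fun N : nat => #|[pred n : 'I_N | f n <= y]|%:R / N%:R : R) =
    (fun N => ecdf f N y) by apply/funext => N; rewrite ecdfE.
apply/cvgn_distP => e e0.
have e2 : 0 < e / 2 by lra.
have [x [z yz [N1 zx]] xG] := G_lt y e0.
move/cvgrPdist_lt : Fy => /(_ _ e2)/nbhs_ballP[d /= d0 Fd].
pose eta := d / 4; have eta0 : 0 < eta by rewrite /eta; lra.
have Gy : G y < G (y - eta - eta) + e / 2.
  have : ball y d (y - eta - eta).
    rewrite /ball/= (_ : y - _ = eta + eta); last by ring.
    by rewrite gtr0_norm /eta; lra.
  by move=> /Fd/=; rewrite !FG => /ltr_normlP[_]; lra.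
have [N2 cN2] := ecdf_almost_cauchy (y - eta) eta0 e2.
exists (maxn N1 N2) => N; rewrite geq_max => /andP[NN1 NN2].
rewrite FG ler_distl; apply/andP; split; last first.
  have := le_ecdf f N (ltW yz); have := zx N NN1; lra.
(* With N fixed, [ecdf_almost_cauchy] bounds [ecdf f M (y - eta)] for all large M by the right-hand
   side, which therefore lies in [upper (y - eta - eta)]. *)
have : G (y - eta - eta) <= ecdf f N y + e / 2.
  apply: G_le; exists (y - eta); first by lra.
  by exists N2 => M NM; have := cN2 M N NM NN2; rewrite subrK.
lra.
Qed.

End Sufficiency.

(** * Continuity points of a monotone function are dense *)

Section ContinuityPoints.
Context {R : realType}.
Variable F : R -> R.
Hypotheses (F_nd : nondecreasing F) (F_rc : right_continuous F).

Lemma discontinuity_of_not_continuous x : ~ {for x, continuous F} ->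
  discontinuity F x.
Proof.
move=> Fx.
have Fl : cvg (F y @[y --> x^'-]).
  apply: nondecreasing_at_left_is_cvgr.
    by near=> z => u v _ _; exact: F_nd.
  near=> z; exists (F x); move=> ? [u /=]; rewrite in_itv/= => /andP[_ ux] <-.
  exact/F_nd/ltW.
have Fr : cvg (F y @[y --> x^'+]) by apply/cvg_ex; exists (F x); exact: F_rc.
split => //; apply/eqP => lr; apply: Fx.
have rE : lim (F y @[y --> x^'+]) = F x by apply/cvg_lim => //; exact: F_rc.
by apply/left_right_continuousP; split; [rewrite -rE -lr|exact: F_rc].
Unshelve. all: by end_near. Qed.

(** Otherwise the interval would consist of discontinuities of a monotone function and be countable,
    against its positive Lebesgue measure. *)
Lemma continuity_point_exists (a b : R) : a < b ->
  exists2 y : R, a < y < b & {for y, continuous F}.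
Proof.
move=> ab; apply: contrapT => noy.
have cnt : countable `]a, b[%classic.
  apply: sub_countable (@discontinuity_countable R a b F _); last first.
    by move=> u v _ _; exact: F_nd.
  apply: subset_card_le => x /= xab; split => //.
  apply: discontinuity_of_not_continuous => Fx; apply: noy.
  by exists x => //; move: xab; rewrite in_itv.
have := countable_lebesgue_measure0 cnt.
rewrite lebesgue_measure_itv/= lte_fin ab -EFinB => -[ba0].
by move: ab; rewrite -subr_gt0 ba0 ltxx.
Qed.

End ContinuityPoints.

(** * The Helly-Bray theorem and tightness *)

Section HellyBray.
Context {R : realType}.
Variables (f : nat -> R) (F : cumulativeBounded (0 : R) (1 : R)).
Hypothesis fF : has_distribution_function f F.

Local Notation mu := (lebesgue_stieltjes_measure F).
Local Notation mfun S := (@measurable_fun _ _ (measurableTypeR R) R setT S).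

Lemma ecdf_cvg y : {for y, continuous F} -> ecdf f N y @[N --> \oo] --> F y.
Proof.
move=> Fy; have := fF Fy; apply: cvg_trans; rewrite (_ : (fun N => ecdf f N y) =
  (fun N : nat => #|[pred n : 'I_N | f n <= y]|%:R / N%:R : R))//.
by apply/funext => N; rewrite ecdfE.
Qed.

Lemma stieltjes_setT : mu setT = 1%E.
Proof. exact: (probability_setT (lebesgue_stieltjes_measure F)). Qed.

Lemma bounded_integrable (S : R -> R) (B : R) : mfun S -> (forall z, `|S z| <= B) ->
  mu.-integrable setT (EFin \o S).
Proof.
move=> mS SB.
have mu_fin : (mu setT < +oo)%E by rewrite stieltjes_setT ltry.
apply: measurable_bounded_integrable => //.
exists B; split; first exact: num_real.
by move=> M BM z _; exact: le_trans (SB z) (ltW BM).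
Qed.

Lemma stieltjes_cst (c : R) : \int[mu]_z c = c.
Proof.
by rewrite Rintegral_cst// [X in fine X](_ : _ = 1%E) ?mulr1//; exact: stieltjes_setT.
Qed.

Lemma Rintegral_ray (y : R) : \int[mu]_z ((z : R) <= y)%R%:R = F y.
Proof.
have mA : measurable (`]-oo, y]%classic : set (measurableTypeR R)).
  exact: measurable_itv.
have -> : (fun z : R => (z <= y)%R%:R) = \1_(`]-oo, y]%classic) :> (R -> R).
  by apply/funext => z; rewrite indicE mem_setE in_itv.
rewrite /Rintegral integral_indic// setIT.
have /= := cdf_lebesgue_stieltjes_id F y.
by rewrite /cdf /distribution /pushforward preimage_id => ->.
Qed.

Lemma mfun_ray (y : R) : mfun (fun z : R => (z <= y)%R%:R).
Proof.
have -> : (fun z : R => (z <= y)%R%:R) = \1_(`]-oo, y]%classic) :> (R -> R).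
  by apply/funext => z; rewrite indicE mem_setE in_itv.
by apply: measurable_indic; exact: measurable_itv.
Qed.

(** This class is a vector space containing the constants and the indicators of rays ending at
    continuity points of F, hence the step functions with jumps at such points. *)
Definition helly_bray_fun (S : R -> R) :=
  [/\ mfun S, exists B, forall z, `|S z| <= B &
      emean (S \o f) N @[N --> \oo] --> \int[mu]_z S z].

Lemma helly_bray_funD S1 S2 : helly_bray_fun S1 -> helly_bray_fun S2 ->
  helly_bray_fun (fun z : R => S1 z + S2 z).
Proof.
move=> [m1 [B1 b1] c1] [m2 [B2 b2] c2]; split.
- exact: measurable_funD.
- by exists (B1 + B2) => z; apply: le_trans (ler_normD _ _) _; exact: lerD.
- rewrite RintegralD//; [|exact: bounded_integrable b1|exact: bounded_integrable b2].
  rewrite (_ : (fun N => _) = (fun N => emean (S1 \o f) N + emean (S2 \o f) N)).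
    exact: cvgD.
  by apply/funext => N; rewrite -emeanD.
Qed.

Lemma helly_bray_funZ c S : helly_bray_fun S -> helly_bray_fun (fun z : R => c * S z).
Proof.
move=> [m1 [B1 b1] c1]; split.
- by apply: measurable_funM => //; exact: measurable_cst.
- by exists (`|c| * B1) => z; rewrite normrM ler_wpM2l.
- rewrite RintegralZl//; last exact: bounded_integrable b1.
  rewrite (_ : (fun N => _) = (fun N => c * emean (S \o f) N)).
    by apply: cvgM => //; exact: cvg_cst.
  by apply/funext => N; rewrite -emeanZ.
Qed.

Lemma helly_bray_fun_cst c : helly_bray_fun (fun=> c).
Proof.
split; first exact: measurable_cst.
  by exists `|c|.
rewrite stieltjes_cst.
apply/cvgn_distP => e e0; exists 1%N => N N1.
by rewrite /comp emean_cst// subrr normr0 ltW.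
Qed.

Lemma helly_bray_fun_ray (y : R) : {for y, continuous F} ->
  helly_bray_fun (fun z : R => (z <= y)%R%:R).
Proof.
move=> Fy; split; first exact: mfun_ray.
  by exists 1 => z; case: (z <= y); rewrite ?normr1// normr0.
by rewrite Rintegral_ray; exact: ecdf_cvg.
Qed.

Let continuity_point (a b : R) : a < b ->
  exists2 y : R, a < y < b & {for y, continuous F}.
Proof.
apply: continuity_point_exists; first exact: cumulative_is_nondecreasing.
exact: cumulative_is_right_continuous.
Qed.

Lemma helly_bray_fun_integrable S : helly_bray_fun S -> mu.-integrable setT (EFin \o S).
Proof. by move=> [mS [B SB] _]; exact: bounded_integrable SB. Qed.

Lemma helly_bray_fun_RintegralD S1 S2 : helly_bray_fun S1 -> helly_bray_fun S2 ->
  \int[mu]_z (S1 z + S2 z) = \int[mu]_z S1 z + \int[mu]_z S2 z.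
Proof. by move=> g1 g2; rewrite RintegralD//; exact: helly_bray_fun_integrable. Qed.

Lemma helly_bray_fun_RintegralZ c S : helly_bray_fun S ->
  \int[mu]_z (c * S z) = c * \int[mu]_z S z.
Proof. by move=> g1; rewrite RintegralZl//; exact: helly_bray_fun_integrable. Qed.

(** The step function grows by one interval (y1, y2] at a time, on which it takes the value h y2.
    Lengths between del / 2 and del are short enough for the uniform continuity of h and long enough
    to reach any point. *)
Lemma step_approximation (h : R -> R) (eta del y0 : R) n : 0 < del ->
  (forall x y : R, `|x - y| <= del -> `|h x - h y| <= eta) ->
  {for y0, continuous F} -> exists (y1 : R) S,
  [/\ y0 + n%:R * (del / 2) <= y1, {for y1, continuous F}, helly_bray_fun S,
      forall z, y0 < z <= y1 -> `|h z - S z| <= eta &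
      forall z, ~~ (y0 < z <= y1) -> S z = 0].
Proof.
move=> del0 hdel Fy0; elim: n => [|n [y1 [S [y01 Fy1 gS hS S0]]]].
  exists y0, (fun=> 0); split => //; first by rewrite mul0r addr0.
    exact: helly_bray_fun_cst.
  by move=> z /andP[+ zy]; rewrite ltNge zy.
have [|y2 /andP[y12 y21] Fy2] := @continuity_point (y1 + del / 2) (y1 + del).
  by lra.
have n0 : 0 <= n%:R * (del / 2) by rewrite mulr_ge0//; lra.
exists y2, (fun z => S z +
  h y2 * ((z <= y2)%R%:R + (-1) * (z <= y1)%R%:R)); split => //.
- by rewrite -natr1 mulrDl; lra.
- apply: helly_bray_funD => //; apply: helly_bray_funZ; apply: helly_bray_funD.
    exact: helly_bray_fun_ray.
  by apply: helly_bray_funZ; exact: helly_bray_fun_ray.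
- move=> z /andP[y0z zy2]; rewrite zy2.
  have [zy1|y1z] := leP z y1.
    by rewrite mulN1r subrr mulr0 addr0 hS// y0z.
  rewrite S0 ?y0z/= -?ltNge// mulr0 addr0 add0r mulr1.
  by apply: hdel; rewrite distrC ger0_norm; lra.
- move=> z; rewrite negb_and -leNgt -ltNge => /orP zout.
  rewrite S0; last first.
    rewrite negb_and -leNgt -ltNge; apply/orP.
    by case: zout => ?; [left|right; lra].
  case: zout => zout.
    rewrite (_ : z <= y2); last by lra.
    rewrite (_ : z <= y1); last by lra.
    ring.
  rewrite leNgt zout/= leNgt (_ : y1 < z)/=; last by lra.
  ring.
Qed.

Lemma cdf_left_tail (e : R) : 0 < e ->
  exists2 y : R, {for y, continuous F} & F y <= e.
Proof.
move=> e0; have /cvgrPdist_le/(_ _ e0)[M [_ MF]] := cumulativeNy F.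
have [|y /andP[_ yM] Fy] := @continuity_point (M - 1) M; first by lra.
exists y => //; have := MF y yM; rewrite /= sub0r normrN.
by apply: le_trans; exact: ler_norm.
Qed.

Lemma cdf_right_tail (e : R) : 0 < e ->
  exists M : R, forall y : R, M < y -> 1 - F y <= e.
Proof.
move=> e0; have /cvgrPdist_le/(_ _ e0)[M [_ MF]] := cumulativey F.
by exists M => y /MF; apply: le_trans; exact: ler_norm.
Qed.

Lemma helly_bray (h : R -> R) (B : R) : mfun h -> (forall z, `|h z| <= B) ->
  (forall eta : R, 0 < eta -> exists2 del : R, 0 < del &
    forall x y : R, `|x - y| <= del -> `|h x - h y| <= eta) ->
  emean (h \o f) N @[N --> \oo] --> \int[mu]_z h z.
Proof.
move=> mh hB huc; apply/cvgn_distP => e e0.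
have B0 : 0 <= B by apply: le_trans (hB 0).
(* The final error is 4 eta from the averages of T, eta from S and 3 eta from the integral of T. The
   B + 1 below avoids dividing by B = 0. *)
pose eta := e / 8; have eta0 : 0 < eta by rewrite /eta; lra.
pose e' := eta / (B + 1); have e'0 : 0 < e' by rewrite divr_gt0//; lra.
have Be' : B * e' <= eta.
  rewrite /e' mulrA ler_pdivrMr; last by lra.
  rewrite mulrC ler_wpM2l//; [exact: ltW|by lra].
have [del del0 hdel] := huc eta eta0.
have [y0 Fy0 y0e] := cdf_left_tail e'0.
have [M MF] := cdf_right_tail e'0.
have [n nM] : exists n : nat, M < y0 + n%:R * (del / 2).
  exists (Num.truncn ((M - y0) / (del / 2))).+1.
  rewrite -ltrBlDl -ltr_pdivrMr; last by lra.
  exact: truncnS_gt.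
have [y1 [S [y01 Fy1 gS hS S0]]] := step_approximation n del0 hdel Fy0.
have y1e : 1 - F y1 <= e' by apply: MF; exact: lt_le_trans y01.
(* T dominates |h - S|: it is eta on (y0, y1] and eta + B outside, where S vanishes. As a member of
   the same class it controls averages and integral alike. *)
pose T (z : R) : R := eta + B * ((z <= y0)%R%:R + (1 + (-1) * (z <= y1)%R%:R)).
have g0 := helly_bray_fun_ray Fy0; have g1 := helly_bray_fun_ray Fy1.
have g2 := helly_bray_funZ (-1) g1; have g3 := helly_bray_funD (helly_bray_fun_cst 1) g2.
have g4 := helly_bray_funD g0 g3; have g5 := helly_bray_funZ B g4.
have gT : helly_bray_fun T := helly_bray_funD (helly_bray_fun_cst eta) g5.
have hST z : `|h z - S z| <= T z.
  rewrite /T; have [zin|zout] := boolP (y0 < z <= y1).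
    apply: le_trans (hS z zin) _; move: zin => /andP[y0z ->].
    by rewrite [z <= y0]leNgt y0z/= mulN1r subrr addr0 mulr0 addr0.
  rewrite S0// subr0; apply: le_trans (hB z) _.
  suff : B * 1 <= B * ((z <= y0)%R%:R + (1 + (-1) * (z <= y1)%R%:R)) by lra.
  apply: ler_wpM2l => //; move: zout; rewrite negb_and -leNgt.
  by case: (z <= y0); case: (z <= y1) => //= _; rewrite ?mulr1 ?mulr0; lra.
have hi := bounded_integrable mh hB; have Si := helly_bray_fun_integrable gS.
have IT : \int[mu]_z T z <= 3 * eta.
  rewrite (helly_bray_fun_RintegralD (helly_bray_fun_cst eta) g5).
  rewrite (helly_bray_fun_RintegralZ _ g4).
  rewrite (helly_bray_fun_RintegralD g0 g3).
  rewrite (helly_bray_fun_RintegralD (helly_bray_fun_cst 1) g2).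
  rewrite (helly_bray_fun_RintegralZ _ g1) !Rintegral_ray !stieltjes_cst.
  have : B * (F y0 + (1 + -1 * F y1)) <= B * (e' + e') by rewrite ler_wpM2l//; lra.
  by lra.
have hS_int : mu.-integrable setT (EFin \o (fun z => h z - S z)).
  have [mS [BS bS] _] := gS.
  apply: (@bounded_integrable _ (B + BS)); first exact: measurable_funB.
  by move=> z; apply: le_trans (ler_normB _ _) _; exact: lerD.
have hSi : `|\int[mu]_z h z - \int[mu]_z S z| <= \int[mu]_z T z.
  rewrite -RintegralB//; apply: le_trans (le_normr_Rintegral _ _) _ => //.
  apply: le_Rintegral => //; last exact: helly_bray_fun_integrable.
  have -> : EFin \o (fun z : R => `|h z - S z|) =
      abse \o (EFin \o (fun z => h z - S z)) by [].
  exact: integrable_abse.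
have [_ _ /cvgn_distP/(_ _ eta0)[N1 N1S]] := gS.
have [_ _ /cvgn_distP/(_ _ eta0)[N2 N2T]] := gT.
exists (maxn N1 N2) => N; rewrite geq_max => /andP[NN1 NN2].
have hSe : `|emean (h \o f) N - emean (S \o f) N| <= emean (T \o f) N.
  have -> : emean (h \o f) N - emean (S \o f) N = emean (fun n => h (f n) - S (f n)) N.
    by rewrite /emean sumrB mulrBl.
  apply: le_trans (ler_norm_emean _ _) _.
  by apply: le_emean => k _; exact: hST.
have := N2T N NN2; rewrite ler_distl => /andP[_ t2].
have t1 := N1S N NN1.
have d1 := ler_distD (emean (S \o f) N) (emean (h \o f) N) (\int[mu]_z h z).
have d2 := ler_distD (\int[mu]_z S z) (emean (S \o f) N) (\int[mu]_z h z).
rewrite distrC in hSi.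
by move: IT t2 t1 d1 d2 hSi hSe; rewrite /eta; lra.
Qed.

Lemma emean_tight (e : R) : 0 < e -> exists2 M : R, 0 < M &
  exists N0, forall N, (N0 <= N)%N ->
    emean (fun n => (M < `|f n|)%R%:R) N <= e.
Proof.
move=> e0; have e4 : 0 < e / 4 by lra.
have [y0 Fy0 y0e] := cdf_left_tail e4.
have [M MF] := cdf_right_tail e4.
have [|y1 /andP[My1 _] Fy1] := @continuity_point M (M + 1); first by lra.
have y1e := MF y1 My1.
have /cvgn_distP/(_ _ e4)[N1 N1c] := ecdf_cvg Fy0.
have /cvgn_distP/(_ _ e4)[N2 N2c] := ecdf_cvg Fy1.
exists (`|y0| + `|y1| + 1); first by rewrite ltr_wpDl// addr_ge0.
exists (maxn 1 (maxn N1 N2)) => N; rewrite !geq_max => /and3P[N0 NN1 NN2].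
have := N1c N NN1; have := N2c N NN2.
rewrite !ler_distl => /andP[h1 _] /andP[_ h2].
apply: (@le_trans _ _ (emean (fun n =>
    (f n <= y0)%R%:R + (1 + -1 * (f n <= y1)%R%:R)) N)).
  apply: le_emean => n _; have := ler_norm y1; have := ler_norm (- y0).
  have := normr_ge0 y0; have := normr_ge0 y1; rewrite normrN => p1 p0 q0 q1.
  have [fy0|fy0] := leP (f n) y0; have [fy1|fy1] := leP (f n) y1;
    case: ltP => //= fM; rewrite ?mulr1 ?mulr0; try lra.
  exfalso; move: fM; rewrite ltNge => /negP; apply.
  by rewrite ler_norml; apply/andP; split; lra.
rewrite emeanD emeanD emeanZ emean_cst//.
by rewrite -/(ecdf f N y0) -/(ecdf f N y1); lra.
Qed.

End HellyBray.

(** * Series criteria and trigonometric estimates near 0 *)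

Section RealFacts.
Context {R : realType}.

Lemma cvgn_fib (u : nat -> R) (l : R) : u N @[N --> \oo] --> l ->
  u (fib k) @[k --> \oo] --> l.
Proof.
move=> /cvgn_distP ul; apply/cvgn_distP => e /ul[N uN].
by exists N.+1 => k Nk; apply: uN; have := leq_fibS k; lia.
Qed.

Lemma cvgn_nneg_sum (g : nat -> R) m (B : R) : (forall k, 0 <= g k) ->
  (forall n, \sum_(m <= k < n) g k <= B) -> cvgn (fun n => \sum_(m <= k < n) g k).
Proof.
move=> g0 gB; apply: nondecreasing_is_cvgn; last by exists B => _ [n _ <-].
apply/nondecreasing_seqP => n; have [mn|nm] := leqP m n.
  by rewrite big_nat_recr//= lerDl.
by rewrite !big_geq// ltnW.
Qed.

Lemma cvgn_abs_sum (g : nat -> R) m (B : R) :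
  (forall n, \sum_(m <= k < n) `|g k| <= B) -> cvgn (fun n => \sum_(m <= k < n) g k).
Proof.
move=> gB; have c1 : cvgn (fun n => \sum_(m <= k < n) `|g k|).
  exact: (@cvgn_nneg_sum _ _ B).
have c2 : cvgn (fun n => \sum_(m <= k < n) (`|g k| + g k)).
  apply: (@cvgn_nneg_sum _ _ (2 * B)) => [k|n].
    by have := ler_norm (- g k); rewrite normrN; lra.
  apply: (@le_trans _ _ (\sum_(m <= k < n) 2 * `|g k|)).
    by apply: ler_sum => k _; have := ler_norm (g k); lra.
  by rewrite -mulr_sumr ler_wpM2l.
rewrite (_ : (fun n => _) = (fun n => \sum_(m <= k < n) (`|g k| + g k) -
    \sum_(m <= k < n) `|g k|)); first exact: is_cvgB.
by apply/funext => n; rewrite big_split/= addrAC subrr add0r.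
Qed.

Lemma sin_lower : exists2 d : R, 0 < d & forall x, `|x| < d -> `|x| / 2 <= `|sin x|.
Proof.
have D1 : 1 = 'D_1 (@sin R) 0.
  by rewrite derive_val cos0.
have : (fun h : R => h^-1 *: ((@sin R \o shift 0) (h *: 1) - sin 0)) @ 0^' --> (1 : R).
  by rewrite [X in _ --> X]D1; exact: derivable_sin.
move=> /cvgrPdist_lt /(_ (1 / 2)) [|d /= d0 dh]; first by lra.
exists d => // x xd; have [->|x0] := eqVneq x 0; first by rewrite normr0 mul0r.
have := dh x; rewrite /ball_/= sub0r normrN => /(_ xd x0).
rewrite sin0 subr0 addr0 [x *: _]mulr1 => h.
have := ler_norm (1 - x^-1 *: sin x); have := ler_norm (x^-1 *: sin x).
rewrite normrM normfV => h1 h2.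
have xp : 0 < `|x| by rewrite normr_gt0.
have : 1 / 2 <= `|x|^-1 * `|sin x| by lra.
by rewrite [_ * `|sin x|]mulrC ler_pdivlMr//; lra.
Qed.

(** The quantity 2 - 2 cos x is |e^{ix} - 1|^2 = 4 sin(x/2)^2, to which [sin_lower] applies. *)
Lemma cos_near0 : exists2 d : R, 0 < d & forall x, `|x| < d ->
  x ^+ 2 / 4 <= 2 - 2 * cos x /\ 3 / 4 <= cos x.
Proof.
have [d1 d10 hd1] := sin_lower.
have /cvgrPdist_lt/(_ (1 / 4)) := @continuous_cos R 0.
case=> [|d2 /= d20 hd2]; first by lra.
exists (Num.min d1 d2); first by rewrite lt_min d10.
move=> x; rewrite lt_min => /andP[x1 x2]; split.
  have : `|x / 2| < d1 by rewrite normrM [`|2^-1|]ger0_norm; lra.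
  move=> /hd1 h; have -> : cos x = 1 - 2 * sin (x / 2) ^+ 2.
    rewrite (_ : cos x = cos ((x / 2) *+ 2)); last by congr cos; rewrite mulr2n; lra.
    by rewrite cos_mulr2n cos2sin2; ring.
  have : (`|x / 2| / 2) ^+ 2 <= `|sin (x / 2)| ^+ 2.
    by rewrite ler_sqr ?nnegrE ?divr_ge0.
  rewrite expr_div_n !real_normK ?num_real//; lra.
have := hd2 x; rewrite /ball_/= sub0r normrN cos0 => /(_ x2).
by move=> h; have := ler_norm (1 - cos x); lra.
Qed.

End RealFacts.

(** * The averages of e^{itf} over [0, F_k) *)

Section CharacteristicRecursion.
Context {R : realType}.
Variables (f a : nat -> R) (t : R).
Hypothesis fa : zrec f a.

Definition avg_cos k := avg (fun n => cos (t * f n)) k.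
Definition avg_sin k := avg (fun n => sin (t * f n)) k.

Lemma avg_cosSS k : avg_cos k.+2 = (1 - fib_weight k) * avg_cos k.+1 +
  fib_weight k * (cos (t * a k.+1) * avg_cos k - sin (t * a k.+1) * avg_sin k).
Proof.
rewrite /avg_cos (avg_zrec fa (fun x => cos (t * x))); congr (_ + _ * _).
rewrite -mulNr -!avgZ -avgD; apply: eq_avg => n _.
by rewrite mulrDr cosD mulNr.
Qed.

Lemma avg_sinSS k : avg_sin k.+2 = (1 - fib_weight k) * avg_sin k.+1 +
  fib_weight k * (sin (t * a k.+1) * avg_cos k + cos (t * a k.+1) * avg_sin k).
Proof.
rewrite /avg_sin (avg_zrec fa (fun x => sin (t * x))); congr (_ + _ * _).
rewrite -!avgZ -avgD; apply: eq_avg => n _.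
by rewrite mulrDr sinD.
Qed.

Definition avg_sqr_norm k := avg_cos k ^+ 2 + avg_sin k ^+ 2.

Lemma avg_sqr_norm_ge0 k : 0 <= avg_sqr_norm k.
Proof. by rewrite addr_ge0 ?sqr_ge0. Qed.

Lemma avg_sqr_norm_le1 k : avg_sqr_norm k <= 1.
Proof.
case: k => [|k].
  by rewrite /avg_sqr_norm /avg_cos /avg_sin /avg /emean invr0 !mulr0 expr0n addr0.
apply: (@le_trans _ _ (avg (fun n => cos (t * f n) ^+ 2) k.+1 +
    avg (fun n => sin (t * f n) ^+ 2) k.+1)).
  by apply: lerD; exact: avg_sqr.
rewrite -avgD -[leRHS](avg_cst 1 k); apply: le_avg => n _.
by rewrite cos2Dsin2.
Qed.

(* [dev k] is |phi_{k+1} - e^{ita_{k+1}} phi_k|^2, where phi_k is the average of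
   e^{itf} over n < F_k. *)
Let dev k := (avg_cos k.+1 -
    (cos (t * a k.+1) * avg_cos k - sin (t * a k.+1) * avg_sin k)) ^+ 2 +
  (avg_sin k.+1 -
    (sin (t * a k.+1) * avg_cos k + cos (t * a k.+1) * avg_sin k)) ^+ 2.

Let step k := (avg_cos k.+1 - avg_cos k) ^+ 2 + (avg_sin k.+1 - avg_sin k) ^+ 2.

Let dev_ge0 k : 0 <= dev k. Proof. by rewrite addr_ge0 ?sqr_ge0. Qed.

(** The identity |(1-w)p + wq|^2 = (1-w)|p|^2 + w|q|^2 - w(1-w)|p-q|^2, where q = e^{ita_{k+1}}
    phi_k has the modulus of phi_k. *)
Lemma avg_sqr_normSS k : avg_sqr_norm k.+2 =
  (1 - fib_weight k) * avg_sqr_norm k.+1 + fib_weight k * avg_sqr_norm k -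
  fib_weight k * (1 - fib_weight k) * dev k.
Proof.
rewrite /avg_sqr_norm /dev avg_cosSS avg_sinSS.
have := cos2Dsin2 (t * a k.+1).
set c := cos _; set s := sin _; set w := fib_weight k.
set x := avg_cos k; set y := avg_sin k; set x' := avg_cos _; set y' := avg_sin _.
move=> cs.
have -> : w * (x ^+ 2 + y ^+ 2) = w * ((c ^+ 2 + s ^+ 2) * (x ^+ 2 + y ^+ 2)).
  by rewrite cs mul1r.
ring.
Qed.

Let stepS k : step k.+1 = fib_weight k ^+ 2 * dev k.
Proof. by rewrite /step /dev avg_cosSS avg_sinSS; ring. Qed.

Let lam : R := (golden R)^-1 ^+ 2.

Let lam_le1 : lam <= 1.
Proof. by rewrite exprn_ile1 ?(ltW goldenV_gt0) ?(ltW goldenV_lt1). Qed.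

Let lam_ge0 : 0 <= lam. Proof. exact: sqr_ge0. Qed.

Let sum_dev_weighted n :
  \sum_(1 <= k < n) fib_weight k * (1 - fib_weight k) * dev k <= 2 + golden R ^+ 2.
Proof.
case: n => [|n].
  by rewrite big_geq//; have := sqr_ge0 (golden R); lra.
(* Write u for [avg_sqr_norm]. In passing from k to k + 1, u_{k+1} + lam u_k drops by w(1-w) [dev k]
   up to an error |w - lam|, and it stays between 0 and 2. *)
have : \sum_(1 <= k < n.+1) fib_weight k * (1 - fib_weight k) * dev k +
    (avg_sqr_norm n.+2 + lam * avg_sqr_norm n.+1) <=
    avg_sqr_norm 2 + lam * avg_sqr_norm 1 +
    \sum_(1 <= k < n.+1) `|fib_weight k - lam|.
  elim: n => [|n IH]; first by rewrite !big_geq// add0r addr0.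
  rewrite [in leLHS]big_nat_recr//= [in leRHS]big_nat_recr//=.
  have := avg_sqr_normSS n.+1.
  have h : (fib_weight n.+1 - lam) * (avg_sqr_norm n.+1 - avg_sqr_norm n.+2) <=
      `|fib_weight n.+1 - lam|.
    apply: le_trans (ler_norm _) _; rewrite normrM ler_piMr//.
    have := avg_sqr_norm_ge0 n.+1; have := avg_sqr_norm_ge0 n.+2.
    have := avg_sqr_norm_le1 n.+1; have := avg_sqr_norm_le1 n.+2.
    by move=> *; rewrite ler_norml; apply/andP; split; lra.
  by move=> E; move: IH h; rewrite E; lra.
have := @sum_fib_weight_cvg R 1 n.+1; rewrite -/lam.
have := avg_sqr_norm_le1 1; have := avg_sqr_norm_le1 2.
have := avg_sqr_norm_ge0 n.+1; have := avg_sqr_norm_ge0 n.+2.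
have := lam_le1; have := lam_ge0.
set S := \sum_(_ <= _ < _) _; set S' := \sum_(_ <= _ < _) _.
move: (avg_sqr_norm _) (avg_sqr_norm _) (avg_sqr_norm _) (avg_sqr_norm _).
move=> u2 u1 un1 un0; nra.
Qed.

Let sum_dev n : \sum_(1 <= k < n) dev k <= 6 * (2 + golden R ^+ 2).
Proof.
(* The weights lie in [1/3, 1/2], so w(1-w) >= 1/3 * 1/2 = 1/6. *)
rewrite -ler_pdivrMl; last by lra.
apply: le_trans (sum_dev_weighted n).
rewrite mulr_sumr big_nat [leRHS]big_nat; apply: ler_sum => k /andP[k0 _].
apply: ler_wpM2r => //; have := @fib_weight_ge R k k0; have := @fib_weight_le R k.
set w := fib_weight k; nra.
Qed.

Let sum_step n : \sum_(1 <= k < n) step k <= 6 * (2 + golden R ^+ 2).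
Proof.
apply: le_trans (sum_dev n).
case: n => [|n]; first by rewrite !big_geq.
suff H : \sum_(1 <= k < n.+2) step k <= \sum_(1 <= k < n.+1) dev k.
  apply: le_trans H; rewrite [leRHS]big_nat_recr//= lerDl.
  by rewrite addr_ge0 ?sqr_ge0.
elim: n => [|n IH].
  rewrite big_nat1 big_geq// /step /avg_cos /avg_sin !avg1 !avg2 !subrr.
  by rewrite expr0n addr0.
rewrite big_nat_recr//= [leRHS]big_nat_recr//= lerD// stepS ler_piMl//.
rewrite exprn_ile1// ?fib_weight_ge0//.
by have := @fib_weight_le R n.+1; lra.
Qed.

(** The summand is |phi_k - e^{ita_{k+1}} phi_k|^2, at most 2 [dev k] + 2 [step k] through the
    intermediate point phi_{k+1}. *)
Lemma sum_cos_avg_sqr_norm n :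
  \sum_(1 <= k < n) (2 - 2 * cos (t * a k.+1)) * avg_sqr_norm k <=
  24 * (2 + golden R ^+ 2).
Proof.
apply: (@le_trans _ _ (\sum_(1 <= k < n) (2 * dev k + 2 * step k))).
  apply: ler_sum => k _; rewrite /avg_sqr_norm /dev /step.
  have := cos2Dsin2 (t * a k.+1).
  set c := cos _; set s := sin _.
  set x := avg_cos k; set y := avg_sin k; set x' := avg_cos _; set y' := avg_sin _.
  move=> cs.
  have -> : (2 - 2 * c) * (x ^+ 2 + y ^+ 2) =
      (x - (c * x - s * y)) ^+ 2 + (y - (s * x + c * y)) ^+ 2.
    transitivity ((1 + (c ^+ 2 + s ^+ 2) - 2 * c) * (x ^+ 2 + y ^+ 2)).
      by rewrite cs; ring.
    ring.
  have sq (p q : R) : (p - q) ^+ 2 <= 2 * p ^+ 2 + 2 * q ^+ 2.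
    by have := sqr_ge0 (p + q); nra.
  have h1 := sq (x' - (c * x - s * y)) (x' - x).
  have h2 := sq (y' - (s * x + c * y)) (y' - y).
  have e1 : x' - (c * x - s * y) - (x' - x) = x - (c * x - s * y) by ring.
  have e2 : y' - (s * x + c * y) - (y' - y) = y - (s * x + c * y) by ring.
  rewrite e1 in h1; rewrite e2 in h2; lra.
rewrite big_split/= -!mulr_sumr.
by have := sum_dev n; have := sum_step n; lra.
Qed.

End CharacteristicRecursion.

(** * A limit distribution forces both series to converge *)

Section Necessity.
Context {R : realType}.
Variables (f a : nat -> R) (F : cumulativeBounded (0 : R) (1 : R)).
Hypothesis fa : zrec f a.
Hypothesis fF : has_distribution_function f F.

Lemma avg_tight (e : R) : 0 < e -> exists2 M : R, 0 < M &
  exists k0, forall k, (k0 <= k)%N ->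
    avg (fun n => (M < `|f n|)%R%:R) k <= e.
Proof.
move=> /(emean_tight fF)[M M0 [N0 HN0]]; exists M => //.
by exists N0.+1 => k Nk; rewrite /avg HN0//; have := leq_fibS k; lia.
Qed.

(* If both m and F_{k+1} + m lie in the bulk of the distribution, then
   a_{k+1} = f (F_{k+1} + m) - f m is bounded. *)
Lemma zrec_coef_bounded : exists2 C : R, 0 <= C &
  forall j, (2 <= j)%N -> `|a j| <= C.
Proof.
have [|M M0 [k0 Hk0]] := @avg_tight (1 / 4); first by lra.
exists (2 * M + \sum_(0 <= j < k0.+1) `|a j|).
  by rewrite addr_ge0 ?sumr_ge0//; lra.
move=> j j2; have [jk|kj] := ltnP j k0.+1.
  rewrite [X in 2 * M + X](bigD1_seq j) ?iota_uniq ?mem_index_iota//=.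
  have : 0 <= \sum_(0 <= i < k0.+1 | i != j) `|a i| by apply: sumr_ge0.
  lra.
suff : `|a j| <= 2 * M.
  by move=> h; rewrite (le_trans h)// lerDl sumr_ge0.
case: j j2 kj => [|[|k]]// _ kj; rewrite leNgt; apply/negP => aM.
pose bad n : R := (M < `|f n|)%R%:R.
have bad0 n : 0 <= bad n by rewrite /bad ler0n.
have badD m : (m < fib k.+1)%N -> 1 <= bad m + bad (fib k.+2 + m)%N.
  move=> mk; rewrite /bad; case: ltP => [_|fm]; first by rewrite lerDl ler0n.
  case: ltP => [_|fm']; first by rewrite lerDr ler0n.
  exfalso; move: aM; rewrite ltNge => /negP; apply.
  have := fa.2 k.+1 m isT mk => E; rewrite E in fm'.
  by have := ler_normB (a k.+2 + f m) (f m); rewrite addrK; lra.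
have kk : (k0 <= k.+3)%N by lia.
have : avg bad k.+3 <= 1 / 4 := Hk0 _ kk.
rewrite /avg /emean ler_pdivrMr ?ltr0n ?fib_gt0// sum_fibSS => h.
have h1 : \sum_(0 <= n < fib k.+1) bad n <= \sum_(0 <= n < fib k.+2) bad n.
  rewrite [leRHS](@big_cat_nat _ _ _ (fib k.+1))//= ?leq_fib//.
  by rewrite lerDl sumr_ge0.
have h2 : (fib k.+1)%:R <= \sum_(0 <= m < fib k.+1) (bad m + bad (fib k.+2 + m)%N).
  apply: (@le_trans _ _ (\sum_(0 <= m < fib k.+1) 1)).
    by rewrite sumr_const_nat subn0.
  by rewrite big_nat [leRHS]big_nat; apply: ler_sum => m /andP[_ /badD].
rewrite big_split/= in h2.
(* Each of the F_{k+1} disjoint pairs m, F_{k+2} + m contains a bad point; this is a proportion of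
   at least 1/3 of [0, F_{k+3}), more than the allowed 1/4. *)
have h3 := @fib_weight_ge R k.+1 isT.
rewrite /fib_weight ler_pdivlMr ?ltr0n ?fib_gt0// in h3.
have : 0 < (fib k.+1)%:R :> R by rewrite ltr0n fib_gt0.
lra.
Qed.

Lemma zrec_coef_sqr_cvg : cvgn (fun n => \sum_(2 <= j < n) a j ^+ 2).
Proof.
have [C C0 aC] := zrec_coef_bounded.
have [d d0 hd] := @cos_near0 R.
have [|M M0 [k0 Hk0]] := @avg_tight (1 / 8); first by lra.
(* So small that t a_j for all j >= 2, and t f(n) whenever |f n| <= M, fall in the window of
   [cos_near0]. *)
pose t := d / (C + M + 1) / 2.
have den : 0 < C + M + 1 by lra.
have t0 : 0 < t by rewrite !divr_gt0.
have tB x : `|x| <= C + M -> `|t * x| < d.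
  move=> xCM; rewrite normrM gtr0_norm// /t.
  rewrite -mulrA -[ltRHS]mulr1 -mulrA ltr_pM2l//.
  by rewrite -mulrA ltr_pdivrMl// mulr1; have := normr_ge0 x; lra.
have avg_cos_lower k : (k0 <= k)%N -> (0 < k)%N -> 1 / 2 <= avg_cos f t k.
  case: k => // k kk _.
  (* The minorant is 3/4 in the bulk and -1 outside it, and 3/4 - 7/4 * 1/8 >= 1/2. *)
  apply: (@le_trans _ _ (avg (fun n => 3 / 4 + (- (7 / 4)) * (M < `|f n|)%R%:R) k.+1)).
    by rewrite avgD avg_cst avgZ; have := Hk0 _ kk; lra.
  apply: le_avg => n _; case: ltP => fM.
    by rewrite mulr1; have := cos_geN1 (t * f n); lra.
  have [|_ h] := hd (t * f n); first by apply: tB; lra.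
  by rewrite mulr0 addr0.
pose k1 := k0.+1.
have u_lower k : (k1 <= k)%N -> 1 / 4 <= avg_sqr_norm f t k.
  move=> kk; have := @avg_cos_lower k; rewrite (ltnW kk) (leq_trans _ kk)//.
  move=> /(_ isT isT) h.
  by rewrite /avg_sqr_norm; have := sqr_ge0 (avg_sin f t k); nra.
have bound n : \sum_(k1 <= k < n) a k.+1 ^+ 2 <= 16 / t ^+ 2 * (24 * (2 + golden R ^+ 2)).
  have tt : 0 < t ^+ 2 by rewrite exprn_gt0.
  have [nk|kn] := leqP n k1.
    by rewrite big_geq// mulr_ge0 ?divr_ge0 ?(ltW tt)//; have := sqr_ge0 (golden R); lra.
  have := sum_cos_avg_sqr_norm t fa n.
  rewrite (@big_cat_nat _ _ _ k1)//=; last exact: ltnW.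
  have pos k : 0 <= (2 - 2 * cos (t * a k.+1)) * avg_sqr_norm f t k.
    by rewrite mulr_ge0 ?avg_sqr_norm_ge0//; have := cos_le1 (t * a k.+1); lra.
  have : 0 <= \sum_(1 <= k < k1) (2 - 2 * cos (t * a k.+1)) * avg_sqr_norm f t k.
    exact: sumr_ge0.
  move=> s1 s2.
  have : \sum_(k1 <= k < n) (t ^+ 2 / 16) * a k.+1 ^+ 2 <=
      \sum_(k1 <= k < n) (2 - 2 * cos (t * a k.+1)) * avg_sqr_norm f t k.
    rewrite big_nat [leRHS]big_nat; apply: ler_sum => k /andP[kk _].
    have [|h _] := hd (t * a k.+1).
      have k2 : (2 <= k.+1)%N by rewrite ltnS (leq_trans _ kk).
      by apply: tB; have := aC _ k2; lra.
    rewrite exprMn in h; have := u_lower k kk; set u := avg_sqr_norm _ _ _ => uk.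
    apply: (@le_trans _ _ ((t ^+ 2 * a k.+1 ^+ 2 / 4) * (1 / 4))); first by lra.
    have sq0 : 0 <= t ^+ 2 * a k.+1 ^+ 2 / 4.
      by rewrite divr_ge0// mulr_ge0// sqr_ge0.
    by apply: ler_pM => //; lra.
  rewrite -mulr_sumr => s3.
  rewrite -ler_pdivrMl ?divr_gt0// invf_div.
  by lra.
apply: (@cvgn_nneg_sum _ _ _ (\sum_(2 <= j < k1.+1) a j ^+ 2 +
    16 / t ^+ 2 * (24 * (2 + golden R ^+ 2)))) => [k|n]; first exact: sqr_ge0.
have [nk|kn] := leqP n k1.+1.
  have := bound k1; rewrite big_geq// => b0.
  apply: (@le_trans _ _ (\sum_(2 <= j < k1.+1) a j ^+ 2)); last by lra.
  have [n2|n2] := leqP 2 n; last first.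
    by rewrite big_geq ?sumr_ge0 1?ltnW// => i _; exact: sqr_ge0.
  rewrite [leRHS](@big_cat_nat _ _ _ n)//= lerDl sumr_ge0// => i _; exact: sqr_ge0.
rewrite (@big_cat_nat _ _ _ k1.+1)//=; last exact: ltnW.
by rewrite lerD2l; case: n kn => // n kn; rewrite big_add1; exact: bound.
Qed.

(** The variance is at most V. A mean exceeding M in modulus by D > 1 + 2 V would be at distance at
    least D from three quarters of the values, forcing a variance of at least 3/4 D^2 > V. *)
Lemma avg_sqr_bounded : exists2 Q : R, 0 <= Q & exists k0, forall k, (k0 <= k)%N ->
  avg (fun n => f n ^+ 2) k <= Q.
Proof.
have [V HV] : exists V, forall n, \sum_(2 <= j < n) a j ^+ 2 <= V.
  have c := zrec_coef_sqr_cvg.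
  exists (limn (fun n => \sum_(2 <= j < n) a j ^+ 2)) => n.
  apply: nondecreasing_cvgn_le => //; apply/nondecreasing_seqP => m.
  have [m2|m2] := leqP 2 m; last by rewrite !big_geq// ltnW.
  by rewrite big_nat_recr//= lerDl sqr_ge0.
have V0 : 0 <= V by have := HV 0%N; rewrite big_geq.
have [|M M0 [k0 Hk0]] := @avg_tight (1 / 4); first by lra.
pose mb := M + 1 + 2 * V.
exists (V + mb ^+ 2); first by rewrite addr_ge0 ?sqr_ge0.
exists k0.+1 => k kk; have k_gt0 : (0 < k)%N by exact: leq_trans kk.
have var := le_trans (variance_le fa k_gt0) (HV _).
have vE : avg (fun n => (f n - mean f k) ^+ 2) k = variance f k.
  case: k {kk var} k_gt0 => // k _.
  rewrite (@eq_avg _ _ (fun n =>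
    (f n ^+ 2 + (- (2 * mean f k.+1)) * f n) + mean f k.+1 ^+ 2)); last first.
    by move=> n _; ring.
  by rewrite avgD avgD avgZ avg_cst /variance /mean; ring.
suff : `|mean f k| <= mb.
  move=> mk; have : mean f k ^+ 2 <= mb ^+ 2.
    by rewrite -real_normK ?num_real// ler_sqr ?nnegrE// (le_trans _ mk).
  by rewrite /variance in var; lra.
rewrite leNgt; apply/negP => mk.
pose D := `|mean f k| - M.
have D0 : 1 + 2 * V < D by rewrite /D /mb in mk *; lra.
have : D ^+ 2 * (3 / 4) <= variance f k.
  rewrite -vE; apply: (@le_trans _ _ (avg (fun n =>
      D ^+ 2 + (- D ^+ 2) * (M < `|f n|)%R%:R) k)).
    rewrite avgD -[X in avg (fun=> _) X](prednK k_gt0) avg_cst avgZ.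
    have := Hk0 _ (ltnW kk).
    by have := sqr_ge0 D; nra.
  apply: le_avg => n _; case: ltP => fM; first by rewrite mulr1 subrr sqr_ge0.
  rewrite mulr0 addr0 -[leRHS]real_normK ?num_real// ler_sqr ?nnegrE//; last by lra.
  have := ler_normB (f n) (f n - mean f k).
  by rewrite opprB addrCA subrr addr0 /D; lra.
nra.
Qed.

Definition trunc (A z : R) : R := Num.max (- A) (Num.min A z).

Lemma trunc_le A z : 0 <= A -> `|trunc A z| <= A.
Proof.
move=> A0; rewrite /trunc ler_norml le_max lexx/= ge_max; apply/andP; split; first by lra.
by rewrite ge_min lexx.
Qed.

Lemma trunc_lip A x y : `|trunc A x - trunc A y| <= `|x - y|.
Proof.
have H u v : u <= v -> trunc A u <= trunc A v <= trunc A u + (v - u).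
  move=> uv; rewrite /trunc /Order.max /Order.min.
  by apply/andP; split; case: (ltP A u) => ?; case: (ltP A v) => ?;
    do ?[case: ltP => ?]; lra.
have [xy|yx] := leP x y.
  have /andP[h1 h2] := H _ _ xy.
  by rewrite distrC [leRHS]distrC ger0_norm ?subr_ge0// ger0_norm ?subr_ge0//; lra.
have /andP[h1 h2] := H _ _ (ltW yx).
by rewrite ger0_norm ?subr_ge0// ger0_norm ?subr_ge0 ?(ltW yx)//; lra.
Qed.

(** Where z is cut off, the error is at most |z| <= z^2 / A. A bound on second moments thus makes
    the truncation error of the means uniform in k. *)
Lemma trunc_approx A z : 0 < A -> `|z - trunc A z| <= z ^+ 2 / A.
Proof.
move=> A0; rewrite ler_pdivlMr// /trunc.
case: (leP A z) => Az; case: (leP (- A) _) => h1; try lra.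
- by rewrite ger0_norm ?subr_ge0//; nra.
- by rewrite subrr normr0 mul0r sqr_ge0.
- by rewrite opprK ler0_norm; nra.
Qed.

Lemma mean_cvg : cvgn (mean f).
Proof.
have [Q Q0 [k0 HQ]] := avg_sqr_bounded.
apply/cvgn_cauchyP => e e0.
pose A := 4 * (Q + 1) / e.
have A0 : 0 < A by rewrite divr_gt0//; lra.
have QA : Q / A <= e / 4.
  rewrite /A invf_div mulrA ler_pdivrMr; last by lra.
  by nra.
have cT : emean (trunc A \o f) N @[N --> \oo] -->
    \int[lebesgue_stieltjes_measure F]_z trunc A z.
  apply: (@helly_bray _ _ _ fF _ A).
  - apply: measurable_maxr; first exact: measurable_cst.
    by apply: measurable_minr; [exact: measurable_cst|exact: measurable_id].
  - by move=> z; apply: trunc_le; exact: ltW.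
  - by move=> eta eta0; exists eta => // x y; apply: le_trans; exact: trunc_lip.
have /cvgn_distP cTf := cvgn_fib cT.
have [|N HN] := cTf (e / 4); first by lra.
have approx k : (k0 <= k)%N -> `|mean f k - avg (trunc A \o f) k| <= e / 4.
  move=> kk; apply: le_trans QA.
  have -> : mean f k - avg (trunc A \o f) k = avg (fun n => f n - trunc A (f n)) k.
    by rewrite /mean /avg /emean sumrB mulrBl.
  apply: le_trans (ler_norm_avg _ _) _.
  apply: (@le_trans _ _ (avg (fun n => A^-1 * f n ^+ 2) k)).
    by apply: le_avg => n _; rewrite mulrC; exact: trunc_approx.
  by rewrite avgZ mulrC ler_wpM2r ?invr_ge0 ?(ltW A0)//; exact: HQ.
exists (maxn k0 N) => m n; rewrite !geq_max => /andP[mk mN] /andP[nk nN].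
have := approx m mk; have := approx n nk; have := HN m mN; have := HN n nN.
rewrite /avg; set I := \int[_]_z _.
set x := emean _ (fib m); set y := emean _ (fib n).
rewrite !ler_distl => /andP[a1 a2] /andP[b1 b2] /andP[c1 c2] /andP[d1 d2].
by apply/andP; split; lra.
Qed.

(** Solving [mean_sum] for the sum of the a_j leaves convergent means and an absolutely convergent
    error series. *)
Lemma zrec_coef_cvg : cvgn (fun n => \sum_(2 <= j < n) a j).
Proof.
have [C C0 aC] := zrec_coef_bounded.
pose lam : R := (golden R)^-1 ^+ 2.
have lam0 : lam != 0 by rewrite expf_neq0// invr_eq0 golden_neq0.
pose g k := (fib_weight k - lam) * (a k.+1 - mean_diff f k).
have cg : cvgn (fun n => \sum_(1 <= k < n) g k).
  apply: (@cvgn_abs_sum _ _ _ (2 * C * golden R ^+ 2)) => n.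
  apply: le_trans (mean_sum_err fa n (ltn0Sn 0) aC) _.
  by rewrite ler_wpM2l ?mulr_ge0//; exact: sum_fib_weight_cvg.
have /cvg_ex[/= m cm] := mean_cvg.
have cm1 : mean f n.+1 @[n --> \oo] --> m by rewrite cvg_shiftS.
move/cvg_ex : cg => [/= l cl].
have cs : lam^-1 * ((mean f n.+1 + lam * mean f n) - \sum_(1 <= k < n) g k)
    @[n --> \oo] --> lam^-1 * (m + lam * m - l).
  exact: (cvgM (cvg_cst _) (cvgB (cvgD cm1 (cvgM (cvg_cst _) cm)) cl)).
apply/cvg_ex; exists (lam^-1 * (m + lam * m - l)).
rewrite -(cvg_shiftS (fun n => \sum_(2 <= j < n) a j)).
move: cs; apply: cvg_trans; apply: near_eq_cvg; near=> n.
have n0 : (0 < n)%N by near: n; exact: nbhs_infty_gt.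
by rewrite (mean_sum fa n0) addrK mulKf.
Unshelve. all: by end_near. Qed.

End Necessity.

(** * The product formula for the characteristic function *)

Section CharacteristicFunction.
Context {R : realType}.

Lemma binet n : Num.sqrt 5 * (fib n)%:R =
  golden R ^+ n - (- (golden R)^-1) ^+ n.
Proof.
have s : Num.sqrt (5 : R) = golden R + (golden R)^-1.
  by rewrite goldenV /golden; lra.
suff : Num.sqrt 5 * (fib n)%:R = golden R ^+ n - (- (golden R)^-1) ^+ n /\
    Num.sqrt 5 * (fib n.+1)%:R = golden R ^+ n.+1 - (- (golden R)^-1) ^+ n.+1.
  by case.
elim: n => [|n [IH1 IH2]].
  by rewrite !expr0 mulr0 subrr !expr1 mulr1 opprK; split.
split => //; rewrite fibSS natrD mulrDr IH1 IH2 !exprS.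
have g2 := @golden_sqr R; have p2 := @goldenV_sqr R; rewrite !expr2 in g2 p2.
set p := (golden R)^-1 in p2 *; set g := golden R in g2 *.
transitivity (g * g * g ^+ n - p * p * (- p) ^+ n); last by ring.
by rewrite g2 p2; ring.
Qed.

Lemma sqrt5_gt0 : 0 < Num.sqrt 5 :> R.
Proof. by rewrite sqrtr_gt0; lra. Qed.

Lemma fib_golden_cvg : (fib n.+1)%:R / golden R ^+ n @[n --> \oo] -->
  golden R / Num.sqrt 5.
Proof.
have s0 := sqrt5_gt0; have g0 := @golden_neq0 R.
have p0 := @goldenV_gt0 R; have p1 := @goldenV_lt1 R.
have gp : 0 < golden R := lt_trans ltr01 golden_gt1.
have E n : (fib n.+1)%:R / golden R ^+ n =
    golden R / Num.sqrt 5 -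
    (Num.sqrt 5)^-1 * ((- (golden R)^-1) ^+ n.+1 * (golden R)^-1 ^+ n).
  have gn : golden R ^+ n != 0 by rewrite expf_neq0.
  have -> : (fib n.+1)%:R = (Num.sqrt 5)^-1 *
      (golden R ^+ n.+1 - (- (golden R)^-1) ^+ n.+1) :> R.
    by rewrite -binet mulKf// gt_eqF.
  by rewrite -mulrA mulrBl exprS mulfK// exprVn; ring.
apply/cvgn_distP => e e0.
have [|N HN] := (cvgn_distP (fun n => (golden R)^-1 ^+ n) 0).1 _ e e0.
  by apply: cvg_expr; rewrite gtr0_norm.
exists N => n Nn; have := HN n Nn; rewrite subr0 E addrAC subrr add0r normrN => h.
apply: le_trans h; rewrite normrM normrM !normrX normrN gtr0_norm ?invr_gt0//.
rewrite (gtr0_norm p0) mulrA ler_piMl ?exprn_ge0 ?(ltW p0) ?(ltW gp)//.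
rewrite mulr_ile1 ?exprn_ge0 ?invr_ge0 ?(ltW s0) ?(ltW gp)//; last first.
  by rewrite exprn_ile1// ltW.
rewrite invf_le1// -[leLHS]sqrtr1 ler_sqrt; lra.
Qed.

Lemma cvg_complex (u v : nat -> R) (x y : R) :
  u n @[n --> \oo] --> x -> v n @[n --> \oo] --> y ->
  ((fun n => (u n +i* v n)%C) : nat -> R[i]^o) @ \oo --> ((x +i* y)%C : R[i]^o).
Proof.
move=> /cvgn_distP ux /cvgn_distP vy; apply/cvgrPdist_le => -[e e'].
(* The order on R[i] compares only numbers with equal imaginary parts, so a positive radius is
   real. *)
rewrite ltcE /= => /andP[/eqP e'0 e0]; rewrite e'0.
have [|N1 HN1] := ux (e / 2); first by lra.
have [|N2 HN2] := vy (e / 2); first by lra.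
exists (maxn N1 N2) => // n /=; rewrite geq_max => /andP[/HN1 h1 /HN2 h2].
rewrite lecE /= eqxx /=.
apply: (@le_trans _ _ (`|x - u n| + `|y - v n|)); last first.
  by rewrite distrC in h1; rewrite distrC in h2; lra.
rewrite -[leRHS](ger0_norm (addr_ge0 (normr_ge0 _) (normr_ge0 _))) -sqrtr_sqr.
rewrite ler_wsqrtr// [in leRHS]sqrrD !real_normK ?num_real//.
by rewrite addrAC lerDl mulrn_wge0// mulr_ge0.
Qed.

(** The addition formulas reduce uniform continuity to continuity at 0. *)
Lemma cos_uniform (t : R) (eta : R) : 0 < eta -> exists2 del : R, 0 < del &
  forall x y : R, `|x - y| <= del ->
    `|cos (t * x) - cos (t * y)| <= eta /\ `|sin (t * x) - sin (t * y)| <= eta.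
Proof.
move=> eta0; have eta2 : 0 < eta / 2 by lra.
have /cvgrPdist_lt/(_ _ eta2)[d1 /= d10 hd1] := @continuous_cos R 0.
have /cvgrPdist_lt/(_ _ eta2)[d2 /= d20 hd2] := @continuous_sin R 0.
pose d := Num.min d1 d2; have d0 : 0 < d by rewrite lt_min d10.
have t1 : 0 < `|t| + 1 by rewrite ltr_wpDl.
exists (d / (`|t| + 1) / 2) => [|x y xy]; first by rewrite !divr_gt0.
pose h := t * x - t * y.
have hd : `|h| < d.
  rewrite /h -mulrBr normrM.
  apply: (@le_lt_trans _ _ ((`|t| + 1) * (d / (`|t| + 1) / 2))).
    by apply: ler_pM => //; rewrite lerDl.
  by rewrite mulrA mulrCA divff ?gt_eqF// mulr1; lra.
move: hd; rewrite /d lt_min => /andP[h1 h2].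
have {hd1} c1 : `|1 - cos h| < eta / 2.
  by have := hd1 h; rewrite /ball_/= sub0r normrN cos0; apply.
have {hd2} s1 : `|sin h| < eta / 2.
  by have := hd2 h; rewrite /ball_/= sub0r normrN sin0 sub0r normrN; apply.
have small (p q : R) : `|p| <= 1 -> `|q| <= 1 ->
    `|p * (1 - cos h)| + `|q * sin h| <= eta.
  move=> p1 q1; rewrite !normrM.
  have : `|p| * `|1 - cos h| <= `|1 - cos h| by rewrite ler_piMl.
  have : `|q| * `|sin h| <= `|sin h| by rewrite ler_piMl.
  lra.
have -> : t * x = t * y + h by rewrite /h; ring.
rewrite (cosD (t * y) h) (sinD (t * y) h); split.
  rewrite (_ : _ - _ = (- cos (t * y)) * (1 - cos h) - sin (t * y) * sin h); last by ring.
  apply: le_trans (ler_normB _ _) _.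
  by apply: small; rewrite ?normrN ?cos_max ?sin_max.
rewrite (_ : _ - _ = (- sin (t * y)) * (1 - cos h) + cos (t * y) * sin h); last by ring.
apply: le_trans (ler_normD _ _) _.
by apply: small; rewrite ?normrN ?cos_max ?sin_max.
Qed.

Variables (f : nat -> R) (F : cumulativeBounded (0 : R) (1 : R)) (t : R).

Lemma avg_cos_cvg : has_distribution_function f F ->
  avg_cos f t k @[k --> \oo] -->
    \int[lebesgue_stieltjes_measure F]_y cos (t * y).
Proof.
move=> fF; apply: (cvgn_fib (u := emean ((fun y => cos (t * y)) \o f))).
apply: (helly_bray fF (B := 1)).
- apply: continuous_measurable_fun => x; apply: continuous_comp.
    exact: mulrl_continuous.
  exact: continuous_cos.
- by move=> z; exact: cos_max.
- move=> eta /(cos_uniform t)[del del0 hdel]; exists del => // x y xy.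
  exact: (hdel x y xy).1.
Qed.

Lemma avg_sin_cvg : has_distribution_function f F ->
  avg_sin f t k @[k --> \oo] -->
    \int[lebesgue_stieltjes_measure F]_y sin (t * y).
Proof.
move=> fF; apply: (cvgn_fib (u := emean ((fun y => sin (t * y)) \o f))).
apply: (helly_bray fF (B := 1)).
- apply: continuous_measurable_fun => x; apply: continuous_comp.
    exact: mulrl_continuous.
  exact: continuous_sin.
- by move=> z; exact: sin_max.
- move=> eta /(cos_uniform t)[del del0 hdel]; exists del => // x y xy.
  exact: (hdel x y xy).2.
Qed.

Hypothesis fa : zrec f (f \o fib).

(* The sum of e^{itf(n)} over n < F_k; the ratio of consecutive sums is r_k. *)
Definition exp_sum k : R[i] :=
  ((avg_cos f t k * (fib k)%:R) +i* (avg_sin f t k * (fib k)%:R))%C.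

Lemma exp_sumSS k : exp_sum k.+2 =
  exp_sum k.+1 + expi (t * f (fib k.+1)) * exp_sum k.
Proof.
rewrite /exp_sum (avg_cosSS t fa) (avg_sinSS t fa) /expi /=.
have w1 : (1 - fib_weight k) * (fib k.+2)%:R = (fib k.+1)%:R :> R.
  rewrite mulrBl /fib_weight divfK ?fib_neq0// mul1r.
  by rewrite fibSS natrD addrK.
have w2 : fib_weight k * (fib k.+2)%:R = (fib k)%:R :> R.
  by rewrite /fib_weight divfK ?fib_neq0.
apply/eqP; rewrite eq_complex /=; apply/andP; split; apply/eqP.
  by rewrite -w1 -w2; ring.
by rewrite -w1 -w2; ring.
Qed.

Lemma exp_sum1 : exp_sum 1 = 1.
Proof.
rewrite /exp_sum /avg_cos /avg_sin !avg1 fa.1 mulr0 cos0 sin0.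
by rewrite mul0r mulr1.
Qed.

Lemma exp_sum2 : exp_sum 2 = 1.
Proof.
rewrite /exp_sum /avg_cos /avg_sin !avg2 fa.1 mulr0 cos0 sin0.
by rewrite mul0r mulr1.
Qed.

Lemma zratioS k : (2 <= k)%N ->
  zratio f t k.+1 = 1 + expi (t * f (fib k)) / zratio f t k.
Proof. by move=> k2; rewrite /= ltnNge k2. Qed.

Local Arguments zratio : simpl never.

Hypothesis r_neq0 : forall j, (2 <= j)%N -> zratio f t j != 0.

(** Dividing [exp_sumSS] by the middle sum gives the recursion of r_j. The product form requires
    only r_j to be nonzero, not the sums. *)
Lemma zratio_exp_sum k : zratio f t k.+2 * exp_sum k.+1 = exp_sum k.+2.
Proof.
elim: k => [|k IH]; first by rewrite exp_sum1 exp_sum2 mulr1.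
rewrite (exp_sumSS k.+1) zratioS// mulrDl mul1r; congr (_ + _).
by rewrite -IH mulrA divfK ?r_neq0.
Qed.

(** The product telescopes to [exp_sum n.+1] / gam^n; the factor F_{n+1} / gam^n is kept apart
    because its limit is known. *)
Lemma prod_zratio n :
  \prod_(2 <= j < n.+2) (zratio f t j / (golden R)%:C%C) =
  ((avg_cos f t n.+1 * ((fib n.+1)%:R / golden R ^+ n)) +i*
   (avg_sin f t n.+1 * ((fib n.+1)%:R / golden R ^+ n)))%C.
Proof.
have g0 : (golden R)%:C%C != 0 by rewrite eq_complex /= eqxx andbT golden_neq0.
transitivity (exp_sum n.+1 / (golden R)%:C%C ^+ n).
  elim: n => [|n IH]; first by rewrite big_geq// exp_sum1 expr0 divr1.
  rewrite big_nat_recr//= IH -zratio_exp_sum exprS invfM mulrACA.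
  by congr (_ * _); exact: mulrC.
have gn : (golden R)%:C%C ^+ n = (golden R ^+ n)%:C%C by rewrite rmorphXn.
apply: (mulIf (expf_neq0 n g0)); rewrite divfK ?expf_neq0// gn.
have gn0 : golden R ^+ n != 0 by rewrite expf_neq0// golden_neq0.
apply/eqP; rewrite eq_complex /= !mulr0 subr0 add0r.
have E (p q : R) : p * (q / golden R ^+ n) * golden R ^+ n = p * q.
  by rewrite -mulrA divfK.
by rewrite !E !eqxx.
Qed.

Lemma zratio_product_cvg : has_distribution_function f F ->
  let P : nat -> R[i]^o := fun n =>
    \prod_(2 <= j < n) (zratio f t j / (golden R)%:C%C) in
  cvgn P /\
  characteristic_function F t = (Num.sqrt 5 / golden R)%:C%C * limn P.
Proof.
move=> fF P.
pose x := \int[lebesgue_stieltjes_measure F]_y cos (t * y).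
pose y := \int[lebesgue_stieltjes_measure F]_y sin (t * y).
pose c := golden R / Num.sqrt 5.
have cx : avg_cos f t n.+1 * ((fib n.+1)%:R / golden R ^+ n) @[n --> \oo] --> x * c.
  apply: cvgM; last exact: fib_golden_cvg.
  by rewrite (cvg_shiftS (avg_cos f t)); exact: avg_cos_cvg.
have cy : avg_sin f t n.+1 * ((fib n.+1)%:R / golden R ^+ n) @[n --> \oo] --> y * c.
  apply: cvgM; last exact: fib_golden_cvg.
  by rewrite (cvg_shiftS (avg_sin f t)); exact: avg_sin_cvg.
have PL : P @ \oo --> (((x * c) +i* (y * c))%C : R[i]^o).
  have := cvg_complex cx cy.
  rewrite -(cvg_shiftS P) -(cvg_shiftS (fun n => P n.+1)).
  by apply: cvg_trans; apply: near_eq_cvg; apply: nearW => n; rewrite -prod_zratio.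
split; first by apply/cvg_ex; eexists; exact: PL.
have -> : limn P = ((x * c) +i* (y * c))%C := cvg_lim (@norm_hausdorff _ _) PL.
(* The prefactor of the formula cancels the limit c of F_{n+1} / gam^n. *)
have cc : Num.sqrt 5 / golden R * c = 1.
  by rewrite /c mulrA divfK ?golden_neq0// divff// gt_eqF// sqrt5_gt0.
rewrite /characteristic_function -/x -/y.
apply/eqP; rewrite eq_complex /= !mul0r subr0 addr0.
by rewrite [_ * (x * c)]mulrCA [_ * (y * c)]mulrCA cc !mulr1 !eqxx.
Qed.

End CharacteristicFunction.

Unset Implicit Arguments.

Theorem theorem7 (R : realType) (f : nat -> R) (f_add : Z_additive f) :
  ((exists F : cumulativeBounded (0 : R) (1 : R),
      has_distribution_function f F) <->
   (cvgn (fun n : nat => \sum_(2 <= j < n) f (fib j)) /\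
    cvgn (fun n : nat => \sum_(2 <= j < n) f (fib j) ^+ 2))) /\
  (forall F : cumulativeBounded (0 : R) (1 : R),
    has_distribution_function f F ->
    forall t : R, (forall j : nat, (2 <= j)%N -> zratio f t j != 0) ->
    let P : nat -> R[i]^o := fun n =>
      \prod_(2 <= j < n) (zratio f t j / (golden R)%:C%C) in
    cvgn P /\
    characteristic_function F t =
      (Num.sqrt 5 / golden R)%:C%C * limn P).
Proof.
have fa := Z_additive_zrec f_add; split.
  split=> [[F fF]|[a1 a2]]; last exact: zrec_distribution_exists fa a1 a2.
  by split; [exact: zrec_coef_cvg fa fF|exact: zrec_coef_sqr_cvg fa fF].
by move=> F fF t r_neq0; exact: zratio_product_cvg fa r_neq0 fF.
Qed.
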